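(* Let $d\ge1$ and let $X_1,X_2,\ldots$ be independent random vectors in $\mathbb{R}^d$ with common probability density $f:\mathbb{R}^d\to[0,\infty)$. Assume that $K:\mathbb{R}^d\to\mathbb{R}$ satisfies $K\in L^1(\mathbb{R}^d)\cap L^2(\mathbb{R}^d)$, $\int K(u)\,du=1$, $\int uK(u)\,du=0$, $\int\|u\|^2|K(u)|\,du<\infty$, and that $f\in C^{1,1}(\mathbb{R}^d)\cap L^2(\mathbb{R}^d)$ has weak Hessian $D^2f\in L^2(\mathbb{R}^d)$. If $h_n\asymp n^{-1/(d+4)}$, then $$\operatorname{MISE}(\widehat f_{h_n})=O\left(n^{-4/(d+4)}\right)\qquad(n\to\infty).$$ If $\|\mathcal L_Kf\|_2>0$, the AMISE-optimal scalar bandwidth, i.e. the minimizer over $h>0$ of $$\operatorname{AMISE}(\widehat f_h)=\frac{h^4}{4}\|\mathcal L_Kf\|_2^2+\frac{R(K)}{nh^d},$$ is $$h_{\operatorname{AMISE}}=\left(\frac{d\,R(K)}{\|\mathcal L_Kf\|_2^2\,n}\right)^{1/(d+4)}.$$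
   Context: $C^{1,1}(\mathbb{R}^d)$ is the class of differentiable functions $f:\mathbb{R}^d\to\mathbb{R}$ whose gradient is Lipschitz continuous on $\mathbb{R}^d$. $D^2f\in L^2(\mathbb{R}^d)$ means that all weak second partial derivatives of $f$ belong to $L^2(\mathbb{R}^d)$. $\widehat f_h(x)=\frac1{nh^d}\sum_{i=1}^nK\left(\frac{x-X_i}{h}\right)$ and $\operatorname{MISE}(\widehat f_h)=\mathbb{E}\int_{\mathbb{R}^d}\{\widehat f_h(x)-f(x)\}^2\,dx$. $\mathcal L_Kf(x)=\operatorname{tr}\{M_2(K)D^2f(x)\}$ with $M_2(K)=\int_{\mathbb{R}^d}uu^\top K(u)\,du$; $R(K)=\int_{\mathbb{R}^d}K(u)^2\,du$; $\|\cdot\|_2$ is the $L^2(\mathbb{R}^d)$ norm. $a_n\asymp b_n$ means that $a_n/b_n$ is bounded above and bounded away from zero for all large $n$. *)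

(* Defs.v *)
From HB Require Import structures.
From mathcomp Require Import all_boot all_order all_algebra.
From mathcomp Require Import all_classical all_reals all_analysis.

Set Implicit Arguments.
Unset Strict Implicit.
Unset Printing Implicit Defensive.

Import Order.TTheory GRing.Theory Num.Theory.
Import numFieldNormedType.Exports.

Local Open Scope classical_set_scope.
Local Open Scope ring_scope.

(* R^d is 'rV[R]_d.  Its measurable sets are the product sigma-algebra of the
   Borel sets of R, i.e. the Borel sets of R^d. *)
Fact rV_display : measure_display.
Proof. exact: default_measure_display. Qed.

Section measurable_rV.
Context {R : realType} {n : nat}.

Definition rVcoord (i : 'I_n) (x : 'rV[R]_n) : R := x ord0 i.

Let rV_set0 : g_sigma_preimage rVcoord set0.
Proof. exact: sigma_algebra0. Qed.

Let rV_setC A : g_sigma_preimage rVcoord A -> g_sigma_preimage rVcoord (~` A).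
Proof. exact: sigma_algebraC. Qed.

Let rV_bigcup (F : (set 'rV[R]_n)^nat) :
  (forall i, g_sigma_preimage rVcoord (F i)) ->
  g_sigma_preimage rVcoord (\bigcup_i (F i)).
Proof. exact: sigma_algebra_bigcup. Qed.

HB.instance Definition _ := @isMeasurable.Build rV_display
  'rV[R]_n (g_sigma_preimage rVcoord) rV_set0 rV_setC rV_bigcup.

End measurable_rV.

Lemma measurable_rVcoord (R : realType) n (i : 'I_n) :
  measurable_fun [set: 'rV[R]_n] (rVcoord i).
Proof.
move=> _ Y mY; rewrite setTI; apply: sub_sigma_algebra => /=.
rewrite -bigcup_seq/=; exists i => /=; first by rewrite mem_index_enum.
by exists Y => //; rewrite setTI.
Qed.

Lemma measurable_fun_rVP (R : realType) d (T : measurableType d) n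
    (f : T -> 'rV[R]_n) :
  (forall i, measurable_fun [set: T] (rVcoord i \o f)) ->
  measurable_fun [set: T] f.
Proof.
move=> mf.
have pre : g_sigma_preimage (fun i => rVcoord i \o f) `<=` measurable.
  apply: smallest_sub; first exact: sigma_algebra_measurable.
  case: n => [|n] in f mf *; first by rewrite big_ord0.
  rewrite -bigcup_mkord_ord; apply: bigcup_sub => i Ii.
  by move=> A [B mB <-]; exact: mf.
move=> _ A mA; apply: pre.
by rewrite g_sigma_preimage_comp; exists A.
Qed.

Section lebesgue_measure_rV.
Context {R : realType}.

Definition rVcons n (p : measurableTypeR R * 'rV[R]_n) : 'rV[R]_n.+1 :=
  \row_j (if unlift ord0 j is Some k then p.2 ord0 k else p.1).

Lemma measurable_rVcons n : measurable_fun setT (@rVcons n).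
Proof.
apply: measurable_fun_rVP => i; case: (unliftP ord0 i) => [k|] ->.
- rewrite (_ : _ \o _ = rVcoord k \o snd).
    apply: measurableT_comp; last exact: measurable_snd.
    exact: measurable_rVcoord.
  by apply/funext => p; rewrite /= /rVcoord mxE liftK.
- rewrite (_ : _ \o _ = fst); first exact: measurable_fst.
  by apply/funext => p; rewrite /= /rVcoord mxE unlift_none.
Qed.

Definition rVtail n (v : 'rV[R]_n.+1) : 'rV[R]_n :=
  \row_j v ord0 (lift ord0 j).

Lemma measurable_rVtail n : measurable_fun setT (@rVtail n).
Proof.
apply: measurable_fun_rVP => i.
rewrite (_ : _ \o _ = rVcoord (lift ord0 i)); first exact: measurable_rVcoord.
by apply/funext => v; rewrite /= /rVcoord mxE.
Qed.

Lemma rVconsK n (p : measurableTypeR R * 'rV[R]_n) :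
  (rVcons p ord0 ord0, rVtail (rVcons p)) = p.
Proof.
case: p => x v; rewrite mxE unlift_none; congr pair.
by apply/rowP => j; rewrite !mxE liftK.
Qed.

Section step.
Variables (n : nat) (m : {sigma_finite_measure set 'rV[R]_n -> \bar R}).

Definition leb_step : set 'rV[R]_n.+1 -> \bar R :=
  pushforward (@lebesgue_measure R \x m)%E (@rVcons n).

Let measurable_rVcons_preimage A :
  measurable A -> measurable (@rVcons n @^-1` A).
Proof. by move=> mA; rewrite -[X in measurable X]setTI; exact: measurable_rVcons. Qed.

Let leb_step0 : leb_step set0 = 0%E.
Proof. by rewrite /leb_step /pushforward preimage_set0 measure0. Qed.

Let leb_step_ge0 A : (0 <= leb_step A)%E.
Proof. by rewrite /leb_step /pushforward; exact: measure_ge0. Qed.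

Let leb_step_sigma_additive : semi_sigma_additive leb_step.
Proof.
move=> F mF tF mUF; rewrite /leb_step /pushforward preimage_bigcup.
apply: measure_semi_sigma_additive.
- by move=> k; exact: measurable_rVcons_preimage.
- apply/trivIsetP => /= i j _ _ ij; rewrite -preimage_setI.
  by move/trivIsetP : tF => /(_ _ _ _ _ ij) ->//; rewrite preimage_set0.
- by rewrite -preimage_bigcup; exact: measurable_rVcons_preimage.
Qed.

HB.instance Definition _ := isMeasure.Build _ _ _ leb_step
  leb_step0 leb_step_ge0 leb_step_sigma_additive.

Let leb_step_sigma_finite : sigma_finite setT leb_step.
Proof.
have [F TF Foo] : exists2 F : (set (measurableTypeR R * 'rV[R]_n))^nat,
    setT = \bigcup_i F i &
    forall i, measurable (F i) /\ ((@lebesgue_measure R \x m) (F i) < +oo)%E.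
  have /sigma_finiteP[F [TF ndF Foo]] := sigma_finiteT (@lebesgue_measure R).
  have /sigma_finiteP[G [TG ndG Goo]] := sigma_finiteT m.
  exists (fun k => F k `*` G k).
  - rewrite -setXTT TF TG predeqE => -[x y]; split.
      move=> [/= [k _ Fkx] [l _ Gly]]; exists (maxn k l) => //; split.
      + by move: x Fkx; exact/subsetPset/ndF/leq_maxl.
      + by move: y Gly; exact/subsetPset/ndG/leq_maxr.
    by move=> [k _ []/= ? ?]; split; exists k.
  - move=> k; have [? ?] := Foo k; have [? ?] := Goo k.
    split; first exact: measurableX.
    by rewrite product_measure1E// lte_mul_pinfty// ge0_fin_numE.
pose g (v : 'rV[R]_n.+1) : measurableTypeR R * 'rV[R]_n :=
  (v ord0 ord0, rVtail v).
have mg : measurable_fun setT g.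
  apply: measurable_fun_pair; last exact: measurable_rVtail.
  exact: (measurable_rVcoord ord0).
exists (fun k => g @^-1` F k).
  by rewrite -preimage_bigcup -TF preimage_setT.
move=> k; split; first by rewrite -[X in measurable X]setTI; apply: mg => //; case: (Foo k).
rewrite /leb_step /pushforward -comp_preimage.
rewrite (_ : g \o @rVcons n = id) ?preimage_id; first by case: (Foo k).
by apply/funext => p; exact: rVconsK.
Qed.

HB.instance Definition _ :=
  Measure_isSigmaFinite.Build _ _ _ leb_step leb_step_sigma_finite.

End step.

(* d-dimensional Lebesgue measure: \d_0 on R^0, then iterated products with the
   one-dimensional Lebesgue measure, transported along R * R^n -> R^(n+1).
   leb_box checks it on boxes. *)
Fixpoint leb n : {sigma_finite_measure set 'rV[R]_n -> \bar R} :=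
  if n is k.+1 then leb_step (leb k) else \d_(0 : 'rV[R]_0).

Definition box n (a b : 'rV[R]_n) : set 'rV[R]_n :=
  [set v | forall i, v ord0 i \in `[a ord0 i, b ord0 i]].

Lemma measurable_box n (a b : 'rV[R]_n) : measurable (box a b).
Proof.
rewrite (_ : box a b =
    \bigcap_(i in [set: 'I_n]) (rVcoord i @^-1` `[a ord0 i, b ord0 i])).
  apply: fin_bigcap_measurable; first exact: finite_finset.
  move=> i _; rewrite -[X in measurable X]setTI.
  by apply: measurable_rVcoord => //; exact: measurable_itv.
apply/seteqP; split => v /=; first by move=> bv i _; exact: bv.
by move=> bv i; exact: (bv i I).
Qed.

Lemma leb_box n (a b : 'rV[R]_n) : (forall i, a ord0 i <= b ord0 i) ->
  leb n (box a b) = (\prod_(i < n) (b ord0 i - a ord0 i))%:E.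
Proof.
elim: n a b => [|n IH] a b ab.
  rewrite big_ord0 /= diracE mem_set//.
  by move=> [].
rewrite big_ord_recl /= /leb_step /pushforward.
rewrite (_ : _ @^-1` _ =
    `[a ord0 ord0, b ord0 ord0] `*` box (rVtail a) (rVtail b)).
  rewrite product_measure1E; [|exact: measurable_itv|exact: measurable_box].
  rewrite IH; last by move=> i; rewrite !mxE.
  rewrite EFinM; congr (_ * _)%E.
    rewrite [LHS](lebesgue_measure_itv `[a ord0 ord0, b ord0 ord0]) /= lte_fin.
    by have := ab ord0; rewrite le_eqVlt => /predU1P[->|->]//; rewrite ltxx subrr.
  by congr EFin; apply: eq_bigr => i _; rewrite !mxE.
apply/seteqP; split => -[x v] /= h.
- split; first by have := h ord0; rewrite mxE unlift_none.
  by move=> i; have := h (lift ord0 i); rewrite !mxE liftK.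
- case: h => hx hv i; case: (unliftP ord0 i) => [k|] ->.
  + by have := hv k; rewrite !mxE liftK.
  + by rewrite mxE unlift_none.
Qed.

End lebesgue_measure_rV.
Arguments leb {R}.

Section densities_and_kernels.
Context {R : realType} {d : nat}.
Notation Rd := 'rV[R]_d.
Implicit Types (f g phi K : Rd -> R) (i j : 'I_d).

Definition enorm (u : Rd) : R := Num.sqrt (\sum_i u ord0 i ^+ 2).

Definition partial i g : Rd -> R := fun x => 'D_(delta_mx ord0 i) g x.

Definition gradient g (x : Rd) : Rd := \row_i partial i g x.

Definition C11 g : Prop :=
  (forall x, differentiable g x) /\
  exists L : R, forall x y,
    enorm (gradient g x - gradient g y) <= L * enorm (x - y).

Definition smooth g : Prop :=
  forall (s : seq 'I_d) x, differentiable (foldr partial g s) x.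

(* C_c^infty(R^d) *)
Definition test_function phi : Prop :=
  smooth phi /\ compact (closure [set x | phi x != 0]).

Definition weak_hessian f (H : Rd -> 'M[R]_d) : Prop :=
  forall i j phi, test_function phi ->
    \int[leb d]_x (f x * partial i (partial j phi) x) =
    \int[leb d]_x (H x i j * phi x).

Definition L2norm g : R := fine ('N[leb d]_2%:E[EFin \o g])%E.

Definition M2 K : 'M[R]_d :=
  \matrix_(i, j) \int[leb d]_u (u ord0 i * u ord0 j * K u).

Definition LK K (H : Rd -> 'M[R]_d) (x : Rd) : R := \tr (M2 K *m H x).

Definition RK K : R := \int[leb d]_u (K u ^+ 2).

(* The second argument of AMISE is the weak Hessian of the density. *)
Definition AMISE K (H : Rd -> 'M[R]_d) (n : nat) (h : R) : R :=
  h ^+ 4 / 4 * L2norm (LK K H) ^+ 2 + RK K / (n%:R * h ^+ d).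

Section sampling.
Context {dOmega : measure_display} {Omega : measurableType dOmega}.
Variables (P : probability Omega R) (X : nat -> {RV P >-> Rd}).

Definition mutually_independent : Prop :=
  forall (s : seq nat) (A : nat -> set Rd), uniq s ->
    (forall k, measurable (A k)) ->
    P (\bigcap_(k in [set` s]) (X k @^-1` A k)) =
    (\prod_(k <- s) P (X k @^-1` A k))%E.

Definition common_density f : Prop :=
  forall k (A : set Rd), measurable A ->
    distribution P (X k) A = (\int[leb d]_(x in A) (f x)%:E)%E.

(* The sample X_1, ..., X_n is X 0, ..., X n.-1. *)
Definition kde K (h : R) (n : nat) (w : Omega) (x : Rd) : R :=
  (n%:R * h ^+ d)^-1 * \sum_(k < n) K (h^-1 *: (x - X k w)).

Definition MISE K f (h : R) (n : nat) : \bar R :=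
  (\int[P]_w \int[leb d]_x (((kde K h n w x - f x) ^+ 2)%:E))%E.

End sampling.
End densities_and_kernels.

Definition asymp {R : realType} (a b : nat -> R) : Prop :=
  exists c C : R, 0 < c /\ \forall n \near \oo, c <= a n / b n <= C.

Definition minimizer {R : realType} (D : set R) (g : R -> R) (h : R) : Prop :=
  D h /\ forall t, D t -> g h <= g t.

(* Main.v *)
Require Import Defs.
From HB Require Import structures.
From mathcomp Require Import all_boot all_order all_algebra.
From mathcomp Require Import all_classical all_reals all_analysis.
From mathcomp Require Import measurable_realfun.
From mathcomp Require Import ring lra.
Import Order.TTheory GRing.Theory Num.Theory.
Import numFieldNormedType.Exports.
Local Open Scope classical_set_scope.
Local Open Scope ring_scope.

(** The mean integrated squared error is, by Tonelli, the integral over x of a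
    pointwise mean squared error, which splits into a variance and a squared
    bias.  The summands of the estimator are independent, so the variance is at
    most 1/n times the second moment of one summand; integrating over x and
    substituting u = (x - y)/h gives R(K)/(n h^d) ([rescaled_sq_integral]).
    The bias at x is the integral of K(u) (f(x - hu) - f(x)) du
    ([rescaled_bias]), and all the analysis is in bounding its L2 norm by a
    multiple of h^2 ([bias_L2]).

    The Hessian of f is only weak, so Taylor's formula is applied to the
    mollified function g = [moll f eta] instead.  Its second derivatives are
    integrals of f against second derivatives of a translate of eta, which by
    the definition of the weak Hessian are the mollified entries of H
    ([hess2_weak]).  Subtracting the first-order term costs nothing, because
    the first moment of K vanishes, and the integral remainder bounds the bias
    of g at x by h^2 times an iterated average, over u with weight |u|^2 |K(u)|
    and over t in [0, 1], of the mollified size of H at x - thu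
    ([kbias_moll_bound]).  An average of translates does not increase the L2
    norm by more than the mass of the weight: this is Cauchy-Schwarz for the
    weight followed by Tonelli and translation invariance ([averaging_sq]),
    and it is used for the averages over u, over t and over the mollifier.
    The resulting bound h^2 W |H|_2, where W bounds the second absolute moment
    of K, does not depend on the mollifier ([kbias_moll_L2]).  When the radius r
    of the support of the mollifier tends to 0, the mollified function converges
    to f with an error of order r (1 + |z|) at z, because f is C^{1,1}; since K
    has a second moment, the bias of the mollified function converges pointwise
    to the bias of f ([kbias_moll_cvg]), and Fatou's lemma carries the bound
    over.

    With h of order n^{-1/(d+4)} both h^4 and 1/(n h^d) are of order
    n^{-4/(d+4)}.  For the AMISE, put hs for the claimed minimizer and
    t = s hs; the value at t minus the value at hs is a positive multiple of
    d s^{d+4} + 4 - (d + 4) s^d, and this is positive for s <> 1, being an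
    instance of the weighted inequality between arithmetic and geometric means
    ([weighted_power_gt]). *)

Set Implicit Arguments.
Unset Strict Implicit.

(** * Affine change of variables for Lebesgue measure *)

Section line_affine.
Context {R : realType}.

Let affine (a b : R) : R -> measurableTypeR R := fun x => a * x + b.

Let measurable_affine a b : measurable_fun [set: measurableTypeR R] (affine a b).
Proof.
apply: measurable_funD => //; exact: mulrl_measurable.
Qed.

Let preimage_affine_gt0 (a b p q : R) : 0 < a ->
  affine a b @^-1` `]p, q]%classic = `](p - b) / a, (q - b) / a]%classic.
Proof.
move=> a0; apply/seteqP; split => x /=; rewrite !in_itv/= /affine.
  by rewrite ltr_pdivrMr// ler_pdivlMr// ltrBlDr lerBrDr [x * a]mulrC.
by rewrite ltr_pdivrMr// ler_pdivlMr// ltrBlDr lerBrDr [x * a]mulrC.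
Qed.

Let preimage_affine_lt0 (a b p q : R) : a < 0 ->
  affine a b @^-1` `]p, q]%classic = `[(q - b) / a, (p - b) / a[%classic.
Proof.
move=> a0; apply/seteqP; split => x /=; rewrite !in_itv/= /affine.
  by rewrite ltr_ndivlMr// ler_ndivrMr// ltrBlDr lerBrDr [x * a]mulrC andbC.
by rewrite ltr_ndivlMr// ler_ndivrMr// ltrBlDr lerBrDr [x * a]mulrC andbC.
Qed.

Local Open Scope ereal_scope.

(** Lebesgue measure is determined by its values on half-open intervals, so it
    is |a| times its own image under x |-> a x + b.  A negative a turns a
    half-open interval into one open on the other side, which has the same
    length. *)
Lemma ge0_integral_line_affine (a b : R) (F : R -> \bar R) :
  (a != 0)%R -> measurable_fun [set: measurableTypeR R] F -> (forall x, 0 <= F x) ->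
  \int[lebesgue_measure]_x F x =
  `|a|%:E * \int[lebesgue_measure]_x F (a * x + b)%R.
Proof.
move=> a0 mF F0.
have an0 : (0 <= `|a|)%R by [].
(* The image measure is hidden behind an equation, so that its structure is
   not unfolded by the rewriting below. *)
have [mu' mu'E] : exists m : {measure set (measurableTypeR R) -> \bar R},
    m = pushforward (@lebesgue_measure R) (affine a b) :> (_ -> _).
  by unshelve eexists; [refine (pushforward (@lebesgue_measure R) (affine a b));
    exact: measurable_affine|].
pose mu := mscale (NngNum an0) mu'.
have muE A : measurable A -> lebesgue_measure A = mu A.
  apply: lebesgue_measure_unique => _ [[p q]] _ <-.
  rewrite /mu/= /mscale/= mu'E /pushforward.
  have [a_lt0|a_gt0|/eqP] := ltgtP a 0%R; last by rewrite (negbTE a0).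
  - rewrite preimage_affine_lt0// !lebesgue_measure_itv/= !lte_fin.
    rewrite ltr_nM2r ?invr_lt0// ltrD2r; case: ifPn; rewrite ?mule0// => pq.
    rewrite -EFinM -EFinB; congr EFin; rewrite ltr0_norm//.
    field.
    exact: a0.
  - rewrite preimage_affine_gt0// !lebesgue_measure_itv/= !lte_fin.
    rewrite ltr_pM2r ?invr_gt0// ltrD2r; case: ifPn; rewrite ?mule0// => pq.
    rewrite -EFinM -EFinB; congr EFin; rewrite gtr0_norm//.
    field.
    exact: a0.
rewrite (@eq_measure_integral _ _ _ _ mu); last by move=> A mA _; exact: muE.
rewrite /mu ge0_integral_mscale//=; congr (_ * _).
rewrite mu'E ge0_integral_pushforward//; exact: measurable_affine.
Qed.

End line_affine.

Section leb_affine.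
Context {R : realType}.
Local Open Scope ereal_scope.

Lemma ge0_integral_leb_rVcons n (F : 'rV[R]_n.+1 -> \bar R) :
  measurable_fun setT F -> (forall x, 0 <= F x) ->
  \int[leb n.+1]_x F x =
  \int[lebesgue_measure]_s \int[leb n]_v F (rVcons (s, v)).
Proof.
move=> mF F0; rewrite /= (ge0_integral_pushforward (@measurable_rVcons R n))//.
rewrite preimage_setT (fubini_tonelli1 (F \o @rVcons R n))//=.
by apply: measurableT_comp => //; exact: measurable_rVcons.
Qed.

Lemma measurable_rV_affine n (a : R) (b : 'rV[R]_n) :
  measurable_fun setT (fun x : 'rV[R]_n => a *: x + b)%R.
Proof.
apply: measurable_fun_rVP => i.
rewrite (_ : _ \o _ = (fun x => a * rVcoord i x + b ord0 i)%R); last first.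
  by apply/funext => x; rewrite /= /rVcoord !mxE.
apply: measurable_funD => //; apply: measurable_funM => //.
exact: measurable_rVcoord.
Qed.

(** Induction on the dimension: after Tonelli the first coordinate is changed
    by the one-dimensional formula and the others by the induction
    hypothesis, each contributing factors |a|. *)
Lemma ge0_integral_leb_affine n (a : R) (b : 'rV[R]_n) (F : 'rV[R]_n -> \bar R) :
  a != 0%R -> measurable_fun setT F -> (forall x, 0 <= F x) ->
  \int[leb n]_x F x = (`|a| ^+ n)%:E * \int[leb n]_x F (a *: x + b)%R.
Proof.
move=> a0; elim: n b F => [|n IH] b F mF F0.
  rewrite expr0 mul1e /= !integral_dirac//=; last first.
    exact: (measurableT_comp mF (measurable_rV_affine _ _)).
  by congr (_ * F _); apply/rowP => -[].
rewrite !ge0_integral_leb_rVcons//; last first.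
  exact: (measurableT_comp mF (measurable_rV_affine _ _)).
have mcons (x : R) : measurable_fun setT (fun v : 'rV[R]_n => rVcons (x, v)).
  by apply: (measurable_fun_pair2 x); exact: measurable_rVcons.
have mFc : measurable_fun setT (fun p : measurableTypeR R * 'rV[R]_n => F (rVcons p)).
  by apply: measurableT_comp => //; exact: measurable_rVcons.
rewrite (@ge0_integral_line_affine _ a (b ord0 ord0))//; last 2 first.
  exact: (measurable_fun_fubini_tonelli_F (F \o @rVcons R n) mFc (fun=> F0 _)).
  by move=> x; apply: integral_ge0 => v _.
rewrite exprS EFinM -muleA; congr (_ * _).
rewrite -ge0_integralZl//; last 2 first.
- apply: (measurable_fun_fubini_tonelli_F
    (fun p : measurableTypeR R * 'rV[R]_n => F (a *: rVcons p + b)%R)) => //.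
  apply: (measurableT_comp (measurableT_comp mF (measurable_rV_affine _ _))).
  exact: measurable_rVcons.
- by move=> x _; apply: integral_ge0 => v _.
apply: eq_integral => x _.
rewrite (IH (rVtail b)) //; last exact: measurableT_comp.
congr (_ * _); apply: eq_integral => v _; congr F.
apply/rowP => j; rewrite !mxE/=; case: (unliftP ord0 j) => [k|] ->.
  by rewrite ?liftK ?unlift_none !mxE.
by rewrite ?unlift_none.
Qed.

End leb_affine.

(** * Smooth bump functions and mollifiers *)

Section flat.
Context {R : realType}.
Implicit Types (p : {poly R}) (x y : R).

(** The functions p(1/x) e^{-1/x}, extended by 0 to x <= 0.  Derivatives of the
    standard function e^{-1/x} are all of this form, so this family is closed
    under differentiation and its members are smooth. *)
Definition flat p x : R := if 0 < x then p.[x^-1] * expR (- x^-1) else 0.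

(** From y^i / i! <= e^y, monomial by monomial. *)
Lemma poly_expR_bounded p :
  exists2 C, 0 <= C & forall y, 0 <= y -> `|p.[y] * expR (- y)| <= C.
Proof.
exists (\sum_(i < size p) `|p`_i| * i`!%:R).
  by apply: sumr_ge0 => i _; rewrite mulr_ge0.
move=> y y0; rewrite normrM (ger0_norm (expR_ge0 _)) horner_coef.
rewrite (le_trans (ler_wpM2r (expR_ge0 _) (ler_norm_sum _ _ _)))//.
rewrite mulr_suml ler_sum// => i _; rewrite normrM -mulrA ler_wpM2l//.
rewrite normrX (ger0_norm y0) expRN ler_pdivrMr ?expR_gt0//.
case: i => -[|i] /= _; first by rewrite expr0 fact0 mul1r; have := expR_ge1Dx y; lra.
rewrite -ler_pdivrMl ?ltr0n ?fact_gt0// mulrC.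
by have := expR_ge1Dxn i y0; lra.
Qed.

Lemma flat_bounded p : exists2 C, 0 <= C & forall x, `|flat p x| <= C.
Proof.
have [C C0 pC] := poly_expR_bounded p; exists C => // x.
rewrite /flat; case: ifPn => [x0|_]; last by rewrite normr0.
by apply: pC; rewrite invr_ge0 ltW.
Qed.

(** The factor x taken out is what makes [flat p] differentiable at 0: its
    difference quotient there is again a member of the family. *)
Lemma flat_mulX p x : flat p x = x * flat ('X * p) x.
Proof.
rewrite /flat; case: ifPn => [x0|_]; last by rewrite mulr0.
by rewrite hornerM hornerX mulrA mulrA mulfV ?gt_eqF// mul1r.
Qed.

Lemma flat_le0 p x : x <= 0 -> flat p x = 0.
Proof. by rewrite /flat leNgt => /negbTE ->. Qed.

Lemma flat_ge0 x : 0 <= flat 1 x.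
Proof. by rewrite /flat; case: ifP => // _; rewrite hornerE mul1r expR_ge0. Qed.

Lemma flat_gt0 x : 0 < x -> 0 < flat 1 x.
Proof. by rewrite /flat => ->; rewrite hornerE mul1r expR_gt0. Qed.

(** On x > 0 this is the chain rule with y = 1/x: the derivative of
    p(y) e^{-y} is (p' - p)(y) e^{-y}, and dy/dx = - y^2.  At 0 both [flat_mulX]
    and the boundedness of the family are used. *)
Lemma is_derive_flat p x :
  is_derive x 1 (flat p) (flat ('X ^+ 2 * (p - p^`())) x).
Proof.
have [x0|x0|->] := ltgtP x 0.
- rewrite flat_le0 ?ltW//.
  apply: (@near_eq_is_derive _ _ _ (cst 0)).
  near=> y; rewrite flat_le0// ltW//; near: y; exact: lt_nbhsl.
- rewrite /flat x0.
  apply: (@near_eq_is_derive _ _ _ ((fun y : R => p.[y] * expR (- y)) \o (fun y => y^-1))).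
    near=> y; rewrite /= ifT//; near: y; exact: lt_nbhsr.
  have dV := @is_deriveV _ id x 1 1 (lt0r_neq0 x0) (is_derive_id x 1).
  have dE y : is_derive y 1 (fun y : R => expR (- y)) (- expR (- y)).
    have := is_derive1_comp (is_derive_expR (- y)) (is_deriveNid y (1:R)).
    by rewrite mulrN1.
  have dP : is_derive x^-1 1 (fun y : R => p.[y] * expR (- y))
      ((p^`() - p).[x^-1] * expR (- x^-1)).
    have H := is_deriveM (is_derive_poly p x^-1) (dE x^-1).
    apply: (is_derive_eq H); rewrite -[_ *: _]/(_ * _) -[X in _ + X]/(_ * _) hornerD hornerN /=; ring.
  apply: (is_derive_eq (is_derive1_comp dP dV)).
  rewrite -[_ *: _]/(_ * _) !hornerE /= -exprVn; ring.
(* The slope function at 0 is [flat (X p)], by [flat_mulX]; applying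
   [flat_mulX] to it once more writes it as x times a bounded function, whence
   its continuity at 0. *)
- rewrite flat_le0//; apply/is_derive1_caratheodory.
  exists (flat ('X * p)); split.
  + by move=> z; rewrite (flat_le0 p (lexx 0)) !subr0 mulrC -flat_mulX.
  + have [C C0 fC] := flat_bounded ('X * ('X * p)).
    rewrite /prop_for /continuous_at (flat_le0 _ (lexx 0)).
    apply/cvgr0Pnorm_le => e e0.
    have eC : 0 < e / (C + 1) by rewrite divr_gt0// ltr_wpDl.
    apply: filterS (@nbhs0_le _ R^o _ eC) => z zC; rewrite flat_mulX normrM.
    rewrite (@le_trans _ _ (`|z| * (C + 1)))//.
      by rewrite ler_wpM2l// (le_trans (fC z))// lerDl.
    by rewrite -ler_pdivlMr ?ltr_wpDl.
  + by rewrite flat_le0.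
Unshelve. all: by end_near.
Qed.

End flat.

Section bump_alg.
Context {R : realType} {d : nat}.
Notation Rd := 'rV[R]_d.

Lemma is_derive_affine (a b s : R) : is_derive s 1 (fun s => a + b * s) b.
Proof.
have := is_derive_poly (a%:P + b *: 'X) s.
rewrite derivD derivC derivZ derivX add0r hornerZ hornerC mulr1.
by congr is_derive; apply/funext => y; rewrite !hornerE.
Qed.

(** The two difference quotients coincide. *)
Lemma is_derive_line (g : Rd -> R) (a v : Rd) (t D : R) :
  is_derive t 1 (fun s : R => g (a + s *: v)) D <->
  is_derive (a + t *: v) v g D.
Proof.
have E : (fun h : R => h^-1 *: (g (h *: v + (a + t *: v)) - g (a + t *: v))) =
    (fun h : R => h^-1 *: (g (a + (h *: 1 + t) *: v) - g (a + t *: v))).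
  apply/funext => h; congr (_ *: (g _ - _)).
  by rewrite addrCA -scalerDl -[_ *: 1]/(_ * 1) mulr1.
by split=> -[dg Dg]; split; move: dg Dg; rewrite /derivable /derive /= E.
Qed.

(** The algebra generated by constants and by the flat functions of affine
    functions of one coordinate.  All that is needed of a mollifier (being
    smooth, bounded and measurable together with its derivatives) follows by
    induction on membership, since the algebra is closed under partial
    derivatives and translations. *)
Inductive bump_alg : (Rd -> R) -> Prop :=
| bump_alg_cst c : bump_alg (fun=> c)
| bump_alg_flat p a c i : bump_alg (fun x => flat p (a + c * x ord0 i))
| bump_algD g1 g2 : bump_alg g1 -> bump_alg g2 ->
    bump_alg (fun x => g1 x + g2 x)
| bump_algM g1 g2 : bump_alg g1 -> bump_alg g2 ->
    bump_alg (fun x => g1 x * g2 x).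

Lemma differentiable_flat_coord p (a c : R) i (x : Rd) :
  differentiable (fun x : Rd => flat p (a + c * x ord0 i)) x.
Proof.
apply: (@differentiable_comp _ _ _ _ (fun x : Rd => a + c * x ord0 i) (flat p)).
  apply: differentiableD; first exact: differentiable_cst.
  apply: differentiableM; first exact: differentiable_cst.
  exact: differentiable_coord.
apply/derivable1_diffP.
exact: (@ex_derive _ _ _ _ _ _ _ (is_derive_flat p (a + c * x ord0 i))).
Qed.

Lemma partial_flat_coord p (a c : R) i j (x : Rd) :
  partial j (fun x : Rd => flat p (a + c * x ord0 i)) x =
  (c * (i == j)%:R) * flat ('X ^+ 2 * (p - p^`())) (a + c * x ord0 i).
Proof.
pose l := fun s : R => a + c * x ord0 i + (c * (i == j)%:R) * s.
have dl (s : R) : is_derive s 1 l (c * (i == j)%:R) by exact: is_derive_affine.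
have H : is_derive (0 : R) 1 (fun s : R => flat p (a + c * (x + s *: delta_mx ord0 j) ord0 i))
    (flat ('X ^+ 2 * (p - p^`())) (a + c * x ord0 i) * (c * (i == j)%:R)).
  have := is_derive1_comp (is_derive_flat p (l 0)) (dl 0).
  have -> : l 0 = a + c * x ord0 i by rewrite /l mulr0 addr0.
  congr is_derive.
  apply/funext => s; rewrite /= /l !mxE eqxx /= eq_sym; congr flat; ring.
have [_] := (is_derive_line (fun x => flat p (a + c * x ord0 i)) x
  (delta_mx ord0 j) 0 _).1 H.
by rewrite /partial scale0r addr0 mulrC.
Qed.

Lemma bump_alg_differentiable g : bump_alg g -> forall x, differentiable g x.
Proof.
elim=> [c x|p a c i x|g1 g2 _ d1 _ d2 x|g1 g2 _ d1 _ d2 x].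
- exact: differentiable_cst.
- exact: differentiable_flat_coord.
- exact: (differentiableD (d1 x) (d2 x)).
- exact: (differentiableM (d1 x) (d2 x)).
Qed.

Lemma bump_alg_partial g i : bump_alg g -> bump_alg (partial i g).
Proof.
elim=> [c|p a c j|g1 g2 b1 d1 b2 d2|g1 g2 b1 d1 b2 d2].
- rewrite (_ : partial _ _ = fun=> 0); first exact: bump_alg_cst.
  by apply/funext => x; rewrite /partial derive_cst.
- rewrite (_ : partial _ _ = fun x => (c * (j == i)%:R) *
      flat ('X ^+ 2 * (p - p^`())) (a + c * x ord0 j)).
    by apply: bump_algM; [exact: bump_alg_cst|exact: bump_alg_flat].
  by apply/funext => x; rewrite partial_flat_coord.
- rewrite (_ : partial _ _ = fun x => partial i g1 x + partial i g2 x).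
    exact: bump_algD.
  apply/funext => x; rewrite /partial (@deriveD _ _ _ g1 g2)//.
    exact/diff_derivable/bump_alg_differentiable.
  exact/diff_derivable/bump_alg_differentiable.
- rewrite (_ : partial _ _ = fun x => g1 x * partial i g2 x + g2 x * partial i g1 x).
    by apply: bump_algD; exact: bump_algM.
  apply/funext => x; rewrite /partial (@deriveM _ _ g1 g2)//.
    exact/diff_derivable/bump_alg_differentiable.
  exact/diff_derivable/bump_alg_differentiable.
Qed.

Lemma bump_alg_smooth g : bump_alg g -> smooth g.
Proof.
move=> bg s x; apply: bump_alg_differentiable.
by elim: s => //= i s; exact: bump_alg_partial.
Qed.

Lemma bump_alg_bounded g : bump_alg g -> exists2 C, 0 <= C & forall x, `|g x| <= C.
Proof.
elim=> [c|p a c i|g1 g2 _ [C1 C10 h1] _ [C2 C20 h2]|g1 g2 _ [C1 C10 h1] _ [C2 C20 h2]].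
- by exists `|c|.
- by have [C C0 h] := flat_bounded p; exists C.
- exists (C1 + C2); first exact: addr_ge0.
  by move=> x; rewrite (le_trans (ler_normD _ _))// lerD.
- exists (C1 * C2); first exact: mulr_ge0.
  by move=> x; rewrite normrM ler_pM.
Qed.

Lemma bump_alg_measurable g : bump_alg g -> measurable_fun setT g.
Proof.
elim=> [c|p a c i|g1 g2 _ m1 _ m2|g1 g2 _ m1 _ m2].
- exact: measurable_cst.
- apply: (@measurableT_comp _ _ _ _ _ _ (flat p) _ (fun x : Rd => a + c * x ord0 i)).
    apply: continuous_measurable_fun => y.
    apply/differentiable_continuous/derivable1_diffP.
    exact: (@ex_derive _ _ _ _ _ _ _ (is_derive_flat p y)).
  apply: measurable_funD => //; apply: measurable_funM => //.
  exact: measurable_rVcoord.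
- exact: measurable_funD.
- exact: measurable_funM.
Qed.

Lemma bump_alg_prod (s : seq 'I_d) (F : 'I_d -> Rd -> R) :
  (forall i, bump_alg (F i)) -> bump_alg (fun x => \prod_(i <- s) F i x).
Proof.
move=> bF; elim: s => [|i s ih].
  rewrite (_ : (fun _ => _) = fun=> 1); first exact: bump_alg_cst.
  by apply/funext => x; rewrite big_nil.
rewrite (_ : (fun _ => _) = fun x => F i x * \prod_(j <- s) F j x).
  exact: bump_algM.
by apply/funext => x; rewrite big_cons.
Qed.

Lemma bump_alg_sum (s : seq 'I_d) (F : 'I_d -> Rd -> R) :
  (forall i, bump_alg (F i)) -> bump_alg (fun x => \sum_(i <- s) F i x).
Proof.
move=> bF; elim: s => [|i s ih].
  rewrite (_ : (fun _ => _) = fun=> 0); first exact: bump_alg_cst.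
  by apply/funext => x; rewrite big_nil.
rewrite (_ : (fun _ => _) = fun x => F i x + \sum_(j <- s) F j x).
  exact: bump_algD.
by apply/funext => x; rewrite big_cons.
Qed.

Lemma bump_alg_shift (z : Rd) g : bump_alg g -> bump_alg (fun x => g (x - z)).
Proof.
elim=> [c|p a c i|g1 g2 _ b1 _ b2|g1 g2 _ b1 _ b2].
- exact: bump_alg_cst.
- rewrite (_ : (fun _ => _) = fun x : Rd =>
      flat p ((a - c * z ord0 i) + c * x ord0 i)); first exact: bump_alg_flat.
  by apply/funext => x; rewrite !mxE; congr flat; ring.
- exact: bump_algD.
- exact: bump_algM.
Qed.

Lemma partial_shift (z : Rd) i g :
  partial i (fun x => g (x - z)) = fun x => partial i g (x - z).
Proof.
by apply/funext => x; rewrite /partial /derive /=; under eq_fun do rewrite -addrA.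
Qed.

End bump_alg.

Section norms.
Context {R : realType} {d : nat}.
Notation Rd := 'rV[R]_d.

(* `|x| is the sup norm of a row vector; [enorm] is the Euclidean one. *)
Lemma ler_coord_norm (x : Rd) i : `|x ord0 i| <= `|x|.
Proof.
rewrite [leRHS]mx_normrE.
have := @le_bigmax_cond _ R ('I_1 * 'I_d)%type 0 (ord0, i) predT (fun j => `|x j.1 j.2|) isT.
by [].
Qed.

Lemma rV_norm_le (x : Rd) (r : R) : 0 <= r ->
  (forall i, `|x ord0 i| <= r) -> `|x| <= r.
Proof.
move=> r0 h; rewrite [leLHS]mx_normrE; apply: bigmax_le => // -[i j] _ /=.
by rewrite (ord1 i).
Qed.

Lemma norm_le_enorm (x : Rd) : `|x| <= enorm x.
Proof.
apply: rV_norm_le; first exact: sqrtr_ge0.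
move=> i; rewrite /enorm -sqrtr_sqr ler_wsqrtr// (bigD1 i)//= lerDl.
by apply: sumr_ge0 => j _; exact: sqr_ge0.
Qed.

Lemma enorm_le_norm (x : Rd) : enorm x <= d%:R * `|x|.
Proof.
rewrite -[leRHS]ger0_norm ?mulr_ge0// -sqrtr_sqr /enorm ler_wsqrtr//.
rewrite (@le_trans _ _ (\sum_(i < d) `|x| ^+ 2))//.
  apply: ler_sum => i _; rewrite -(real_normK (num_real (x ord0 i))).
  by rewrite lerXn2r// ?nnegrE// ler_coord_norm.
rewrite sumr_const card_ord -[leLHS]mulr_natl exprMn ler_wpM2r ?sqr_ge0//.
by rewrite -natrX ler_nat; case: d => // n; rewrite leq_pmulr.
Qed.

Lemma box_norm (r : R) : 0 <= r ->
  box (const_mx (- r)) (const_mx r) = [set x : Rd | `|x| <= r].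
Proof.
move=> r0; apply/seteqP; split => x /=.
  move=> h; apply: rV_norm_le => // i; have := h i.
  by rewrite in_itv/= !mxE ler_norml.
by move=> h i; rewrite in_itv/= !mxE -ler_norml (le_trans (ler_coord_norm _ _)).
Qed.

End norms.

Section mollifier.
Context {R : realType} {d : nat}.
Notation Rd := 'rV[R]_d.

(** The support lies in a closed ball of the sup norm, hence is compact. *)
Lemma bump_alg_test_function (r : R) (g : Rd -> R) : bump_alg g ->
  (forall x, r < `|x| -> g x = 0) -> test_function g.
Proof.
move=> bg out; split; first exact: bump_alg_smooth.
apply: bounded_closed_compact; last exact: closed_closure.
have sub : closure [set x | g x != 0] `<=` [set x : Rd | `|x| <= r].
  have cl : closed [set x : Rd | `|x| <= r].
    apply: (@closed_comp _ _ (fun x : Rd => `|x|) [set y | y <= r]).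
      by move=> x _; exact: norm_continuous.
    exact: closed_le.
  rewrite [X in _ `<=` X]((closure_id _).1 cl).
  apply: closure_subset => x /=; rewrite leNgt; apply: contra => /out ->//.
exists r; split; first exact: num_real.
by move=> M rM x /sub /= xr; rewrite (le_trans xr)// ltW.
Qed.

(** The support condition is on the sup norm, whose balls are boxes. *)
Definition mollifier (r : R) (eta : Rd -> R) := [/\ bump_alg eta,
  (forall x, 0 <= eta x), (\int[leb d]_x (eta x)%:E = 1)%E &
  (forall x, r < `|x| -> eta x = 0)].

(** The product over i of [flat 1 (1 + x_i / r) * flat 1 (1 - x_i / r)] is
    positive exactly in the open sup-norm ball of radius r; it is divided by
    its integral, which is finite because the function is bounded with bounded
    support, and positive because the function is positive on the box of
    half-width r/2. *)
Lemma exists_mollifier (r : R) : 0 < r -> exists eta, mollifier r eta.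
Proof.
move=> r0.
pose b (x : Rd) := \prod_(i < d) (flat 1 (1 + r^-1 * x ord0 i) * flat 1 (1 + (- r^-1) * x ord0 i)).
have bb : bump_alg b.
  by apply: bump_alg_prod => i; apply: bump_algM; exact: bump_alg_flat.
have b0 x : 0 <= b x.
  by apply: prodr_ge0 => i _; apply: mulr_ge0; exact: flat_ge0.
have mb := bump_alg_measurable bb.
have bout x : r < `|x| -> b x = 0.
  move=> rx; have [i xi] : exists i, r < `|x ord0 i|.
    apply: contrapT => /forallNP h; move: rx; rewrite ltNge => /negP; apply.
    by apply: rV_norm_le; [exact: ltW|move=> i; rewrite leNgt; exact/negP].
  rewrite /b (bigD1 i)//=.
  move: xi; rewrite lter_normr => /orP[xi|xi].
    rewrite [X in _ * X * _]flat_le0 ?mulr0 ?mul0r//.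
    by rewrite mulNr subr_le0 ler_pdivlMl// mulr1 ltW.
  rewrite [X in X * _ * _]flat_le0 ?mul0r ?mul0r//.
  have : r^-1 * x ord0 i < -1 by rewrite ltr_pdivrMl// mulrN1 ltrNr.
  by move=> ?; lra.
have bin x : `|x| < r -> 0 < b x.
  move=> xr; apply: prodr_gt0 => i _; have := le_lt_trans (ler_coord_norm x i) xr.
  rewrite ltr_norml => /andP[h1 h2]; apply: mulr_gt0; apply: flat_gt0.
    have : -1 < r^-1 * x ord0 i by rewrite ltr_pdivlMl// mulrN1.
    by move=> ?; lra.
  by rewrite mulNr subr_gt0 ltr_pdivrMl// mulr1.
have bI : (\int[leb d]_x (b x)%:E < +oo)%E.
  have [C C0 bC] := bump_alg_bounded bb.
  have -> : (\int[leb d]_x (b x)%:E = \int[leb d]_(x in box (const_mx (- r)%R) (const_mx r)) (b x)%:E)%E.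
    rewrite [RHS]integral_mkcond; apply: eq_integral => x _; rewrite patchE.
    case: ifPn => //; rewrite notin_setE box_norm ?ltW//= => /negP; rewrite -ltNge => rx.
    by rewrite bout.
  rewrite (@le_lt_trans _ _ (C%:E * leb d (box (const_mx (- r)%R) (const_mx r)))%E)//.
    rewrite -integral_cst; last exact: measurable_box.
    apply: ge0_le_integral => //=.
    - exact: measurable_box.
    - by move=> x _; rewrite lee_fin.
    - by apply/measurable_EFinP/measurable_funTS.
    - by move=> x _; rewrite lee_fin (le_trans (ler_norm _)).
  rewrite leb_box; last by move=> i; rewrite !mxE; lra.
  by rewrite -EFinM ltry.
have bI0 : (0 < \int[leb d]_x (b x)%:E)%E.
  rewrite lt_neqAle integral_ge0 ?andbT; last by move=> x _; rewrite lee_fin.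
  apply/eqP => /esym Ib0.
  have : (leb d).-negligible [set x | b x != 0].
    have : ae_eq (leb d) setT (EFin \o b) (cst 0%E).
      apply/ae_eq_integral_abs => //; first exact/measurable_EFinP.
      by rewrite -[RHS]Ib0; apply: eq_integral => x _; rewrite gee0_abs ?lee_fin.
    move=> [A [mA A0 hA]]; exists A; split=> // x /= bx0; apply: hA => /= /(_ I) [].
    exact/eqP.
  have sub : box (const_mx (- (r/2))) (const_mx (r/2)) `<=` [set x | b x != 0].
    rewrite box_norm ?divr_ge0 ?ltW// => x /= xr; rewrite gt_eqF// bin//.
    by rewrite (le_lt_trans xr)//; lra.
  move=> /(negligibleS sub)/negligibleP => /(_ (measurable_box _ _)).
  have r2 i : (const_mx (- (r/2)) : Rd) ord0 i <= (const_mx (r/2) : Rd) ord0 i.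
    by rewrite !mxE; lra.
  move=> /(etrans (esym (leb_box r2)))/eqP; rewrite eqe => /eqP.
  by apply/eqP; rewrite gt_eqF// prodr_gt0// => i _; rewrite !mxE; lra.
have bIE : (\int[leb d]_x (b x)%:E)%E = (fine (\int[leb d]_x (b x)%:E))%:E.
  by rewrite fineK// ge0_fin_numE// ltW.
move: bI0; rewrite bIE lte_fin; set c := fine _ => c0.
exists (fun x => c^-1 * b x).
have bcb : bump_alg (fun x => c^-1 * b x).
  by apply: bump_algM => //; exact: bump_alg_cst.
have out x : r < `|x| -> c^-1 * b x = 0 by move=> /bout ->; rewrite mulr0.
split => //.
- by move=> x; rewrite mulr_ge0// invr_ge0 ltW.
- under eq_integral do rewrite EFinM.
  rewrite ge0_integralZl//=.
  + by rewrite bIE -/c -EFinM mulVf// gt_eqF.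
  + exact/measurable_EFinP.
  + by move=> x _; rewrite lee_fin.
  + by rewrite lee_fin invr_ge0 ltW.
Qed.

End mollifier.

(** * Measurability and integrability *)

Section measurability.
Context {R : realType}.

Section rV.
Context {d : measure_display} {T : measurableType d} {n : nat}.

Lemma measurable_fun_coord (i : 'I_n) (f : T -> 'rV[R]_n) :
  measurable_fun setT f -> measurable_fun setT (fun x => f x ord0 i).
Proof. by move=> mf; exact: measurableT_comp (measurable_rVcoord i) mf. Qed.

Lemma measurable_rVD (f g : T -> 'rV[R]_n) :
  measurable_fun setT f -> measurable_fun setT g ->
  measurable_fun setT (fun x => f x + g x).
Proof.
move=> mf mg; apply: measurable_fun_rVP => i.
rewrite (_ : _ \o _ = (fun x => f x ord0 i + g x ord0 i)); last first.
  by apply/funext => x; rewrite /= /rVcoord !mxE.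
by apply: measurable_funD; exact: measurable_fun_coord.
Qed.

Lemma measurable_rVZ (c : T -> R) (g : T -> 'rV[R]_n) :
  measurable_fun setT c -> measurable_fun setT g ->
  measurable_fun setT (fun x => c x *: g x).
Proof.
move=> mf mg; apply: measurable_fun_rVP => i.
rewrite (_ : _ \o _ = (fun x => c x * g x ord0 i)); last first.
  by apply/funext => x; rewrite /= /rVcoord !mxE.
by apply: measurable_funM => //; exact: measurable_fun_coord.
Qed.

Lemma measurable_rVN (g : T -> 'rV[R]_n) :
  measurable_fun setT g -> measurable_fun setT (fun x => - g x).
Proof.
move=> mg; rewrite (_ : (fun _ => _) = fun x => -1 *: g x).
  exact: measurable_rVZ.
by apply/funext => x; rewrite scaleN1r.
Qed.

Lemma measurable_fun_bigsum I (s : seq I) (h : I -> T -> R) :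
  (forall i, measurable_fun setT (h i)) ->
  measurable_fun setT (fun x => \sum_(i <- s) h i x).
Proof.
move=> mh; elim: s => [|i s ih].
  by under eq_fun do rewrite big_nil; exact: measurable_cst.
by under eq_fun do rewrite big_cons; exact: measurable_funD.
Qed.

End rV.

(** Positive and negative parts are treated separately, by Tonelli; in
    particular no integrability of the sections is involved. *)
Lemma measurable_integral_param d1 d2 (T1 : measurableType d1)
    (T2 : measurableType d2) (m2 : {sigma_finite_measure set T2 -> \bar R})
    (F : T1 * T2 -> R) : measurable_fun setT F ->
  measurable_fun setT (fun x => \int[m2]_y (F (x, y))).
Proof.
move=> mF; apply: measurableT_comp => //.
have mE : measurable_fun setT (EFin \o F) by exact/measurable_EFinP.
have -> : (fun x => \int[m2]_y (EFin (F (x, y))))%E =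
   ((fun x => \int[m2]_y (EFin \o F)^\+ (x, y)) \-
    (fun x => \int[m2]_y (EFin \o F)^\- (x, y)))%E.
  apply/funext => x; rewrite [LHS]integralE.
  by congr (_ - _)%E; apply: eq_integral => y _; rewrite ?funeposE ?funenegE.
apply: emeasurable_funB.
  apply: (measurable_fun_fubini_tonelli_F (m2 := m2) (EFin \o F)^\+)%E => //.
  exact: measurable_funepos.
apply: (measurable_fun_fubini_tonelli_F (m2 := m2) (EFin \o F)^\-)%E => //.
exact: measurable_funeneg.
Qed.

Lemma measurable_eintegral_param d1 d2 (T1 : measurableType d1)
    (T2 : measurableType d2) (m2 : {sigma_finite_measure set T2 -> \bar R})
    (F : T1 * T2 -> \bar R) : measurable_fun setT F -> (forall z, 0 <= F z)%E ->
  measurable_fun setT (fun x => \int[m2]_y (F (x, y)))%E.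
Proof. by move=> mF F0; exact: (measurable_fun_fubini_tonelli_F (m2 := m2) F). Qed.

End measurability.

(** Structural measurability.  At a composition with a function g, a hypothesis
    on g is looked for up to syntactic equality: unification up to conversion
    would unfold g, or match a hypothesis on another function. *)
Ltac meas_step := lazymatch goal with
  | |- measurable_fun _ (fun=> ?c) => exact: measurable_cst
  | |- measurable_fun _ (fun x => x) => exact: measurable_id
  | |- measurable_fun _ (EFin \o _) => apply/measurable_EFinP
  | |- measurable_fun _ (fun x => EFin _) => apply/measurable_EFinP
  | |- measurable_fun _ (fun x => x.1) => exact: measurable_fst
  | |- measurable_fun _ (fun x => x.2) => exact: measurable_snd
  | |- measurable_fun _ (fun x => (@?f x).1) =>
      apply: (@measurableT_comp _ _ _ _ _ _ fst _ f (@measurable_fst _ _ _ _))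
  | |- measurable_fun _ (fun x => (@?f x).2) =>
      apply: (@measurableT_comp _ _ _ _ _ _ snd _ f (@measurable_snd _ _ _ _))
  | |- measurable_fun _ (fun x => (_, _)) => apply: measurable_fun_pair
  | |- measurable_fun _ (fun x => - (@?f x)) =>
      first [refine (@measurable_rVN _ _ _ _ f _)
            |refine (@measurable_funN _ _ _ _ f _)]
  | |- measurable_fun _ (fun x => @?f x + @?g x) =>
      first [refine (@measurable_rVD _ _ _ _ f g _ _)
            |refine (@measurable_funD _ _ _ _ f g _ _)]
  | |- measurable_fun _ (fun x => @?f x * @?g x) =>
      refine (@measurable_funM _ _ _ _ f g _ _)
  | |- measurable_fun _ (fun x => @?f x *: @?g x) =>
      refine (@measurable_rVZ _ _ _ _ f g _ _)
  | |- measurable_fun _ (GRing.scale ?c) =>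
      refine (@measurable_rVZ _ _ _ _ (fun=> c) (fun x => x) _ _)
  | |- measurable_fun _ (GRing.add ?c) =>
      first [refine (@measurable_rVD _ _ _ _ (fun=> c) (fun x => x) _ _)
            |refine (@measurable_funD _ _ _ _ (fun=> c) (fun x => x) _ _)]
  | |- measurable_fun _ (fun x => _ ^+ _) => apply: measurable_funX
  | |- measurable_fun _ (fun x => \sum_(i <- _) _) => apply: measurable_fun_bigsum => ?
  | |- measurable_fun _ (fun x => `|@?f x|) =>
      refine (@measurableT_comp _ _ _ _ _ _ _ _ f (@normr_measurable _ setT) _)
  | |- measurable_fun _ (fun x => fun_of_matrix (@?f x) ord0 _) => apply: measurable_fun_coord
  | |- measurable_fun _ (fun x => (_ * _)%E) => apply: emeasurable_funM
  | |- measurable_fun _ (fun x => ?g (@?f x)) =>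
      match goal with
      | H : measurable_fun _ ?g' |- _ => constr_eq g g';
          apply: (@measurableT_comp _ _ _ _ _ _ g _ f H)
      end
  | |- measurable_fun _ ?g =>
      match goal with H : measurable_fun _ ?g' |- _ => constr_eq g g'; exact: H end
  end.
Ltac meas := repeat meas_step.

Section Rintegral_extra.
Context d (T : measurableType d) (R : realType)
  (mu : {measure set T -> \bar R}).

(** When the integral is infinite or undefined, its real part is 0. *)
Lemma abs_Rintegral_le (F : T -> R) : measurable_fun setT F ->
  ((`| \int[mu]_x F x |)%:E <= \int[mu]_x (`|F x|)%:E)%E.
Proof.
move=> mF.
have := @le_abse_integral _ _ _ mu setT (EFin \o F) measurableT.
move=> /(_ ((measurable_EFinP _ _).2 mF)); apply: le_trans.
rewrite /Rintegral; case: (\int[mu]_x _)%E => //= ; rewrite normr0 ?leey//.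
Qed.

Lemma Rintegral_sum I (s : seq I) (h : I -> T -> R) :
  (forall i, mu.-integrable setT (EFin \o h i)) ->
  \int[mu]_x (\sum_(i <- s) h i x) = \sum_(i <- s) \int[mu]_x h i x /\
  mu.-integrable setT (EFin \o (fun x => \sum_(i <- s) h i x)).
Proof.
move=> ih; elim: s => [|i s [ihs ihi]].
  under eq_fun do rewrite big_nil.
  rewrite big_nil; split; last exact: integrable0.
  by rewrite /Rintegral (eq_integral (cst 0%E)) ?integral0// => x _; rewrite big_nil.
split.
  rewrite big_cons -ihs -RintegralD//.
  by apply: eq_Rintegral => x _; rewrite big_cons.
have -> : EFin \o (fun x => \sum_(j <- i :: s) h j x) =
   ((EFin \o h i) \+ (EFin \o (fun x => \sum_(j <- s) h j x)%R))%E.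
  by apply/funext => x /=; rewrite big_cons EFinD.
exact: integrableD.
Qed.

Lemma integrable_mul_bounded (f g : T -> R) (C : R) :
  mu.-integrable setT (EFin \o f) -> measurable_fun setT g ->
  (forall x, `|g x| <= C) -> mu.-integrable setT (EFin \o (fun x => f x * g x)).
Proof.
move=> fi mg gC.
have mf : measurable_fun setT f by apply/measurable_EFinP; exact: measurable_int fi.
have -> : EFin \o (fun x => f x * g x) = ((EFin \o f) \* (EFin \o g))%E.
  by apply/funext.
apply: integrableMl => //.
exists C; split; first exact: num_real.
by move=> M CM x _ /=; rewrite (le_trans (gC x))// ltW.
Qed.

Lemma le_integrableR (f g : T -> R) : measurable_fun setT f ->
  (forall x, `|f x| <= g x) ->
  mu.-integrable setT (EFin \o g) -> mu.-integrable setT (EFin \o f).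
Proof.
move=> mf fg; apply: le_integrable => //; first exact/measurable_EFinP.
by move=> x _ /=; rewrite lee_fin (le_trans (fg x))// ler_norm.
Qed.

End Rintegral_extra.

(** * Second-order Taylor formula with integral remainder *)

Section taylor.
Context {R : realType} {d : nat}.
Notation Rd := 'rV[R]_d.

Lemma continuous_bigsum I (s : seq I) (h : I -> R -> R) (t : R) :
  (forall i, h i x @[x --> t] --> h i t) ->
  \sum_(i <- s) h i x @[x --> t] --> \sum_(i <- s) h i t.
Proof.
move=> ch; elim: s => [|i s ih].
  by under eq_fun do rewrite big_nil; rewrite big_nil; exact: cvg_cst.
by under eq_fun do rewrite big_cons; rewrite big_cons; exact: cvgD.
Qed.

Lemma derive_partialE (g : Rd -> R) (z v : Rd) : differentiable g z ->
  'D_v g z = \sum_i v ord0 i * partial i g z.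
Proof.
move=> dg; rewrite deriveE// [in LHS](row_sum_delta v) linear_sum.
by apply: eq_bigr => i _; rewrite linearZ/= /partial deriveE.
Qed.

Lemma is_derive_along (g : Rd -> R) (a v : Rd) (t : R) :
  differentiable g (a + t *: v) ->
  is_derive t 1 (fun s : R => g (a + s *: v))
    (\sum_i v ord0 i * partial i g (a + t *: v)).
Proof.
move=> dg; apply/is_derive_line; rewrite -derive_partialE//.
exact/derivableP/diff_derivable.
Qed.

(** The function phi(t) + (1 - t) phi'(t) has derivative (1 - t) phi''(t). *)
Lemma taylor2_integral (phi dphi ddphi : R -> R) :
  (forall t : R, is_derive t 1 phi (dphi t)) ->
  (forall t : R, is_derive t 1 dphi (ddphi t)) -> continuous ddphi ->
  \int[lebesgue_measure]_(t in `[0, 1]) ((1 - t) * ddphi t) =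
  phi 1 - phi 0 - dphi 0.
Proof.
move=> d1 d2 cd.
pose F t := phi t + (1 + -1 * t) * dphi t.
have dF (t : R) : is_derive t 1 F ((1 - t) * ddphi t).
  have H := is_deriveD (d1 t) (is_deriveM (is_derive_affine 1 (-1) t) (d2 t)).
  apply: (is_derive_eq H); rewrite -![_ *: _]/(_ * _); ring.
have cF : continuous F.
  move=> t; apply/differentiable_continuous/derivable1_diffP.
  exact: (@ex_derive _ _ _ _ _ _ _ (dF t)).
rewrite /Rintegral (@continuous_FTC2 _ _ F)//.
- rewrite /F; apply: EFin_inj; rewrite -EFinB fineK//; congr EFin; ring.
- apply: continuous_subspaceT => t.
  by apply: cvgM; [apply: cvgB; [exact: cvg_cst|exact: cvg_id]|exact: cd].
- split.
  + by move=> t _; exact: (@ex_derive _ _ _ _ _ _ _ (dF t)).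
  + exact/cvg_at_right_filter/cF.
  + exact/cvg_at_left_filter/cF.
- by move=> t _; rewrite derive1E; exact: (@derive_val _ _ _ _ _ _ _ (dF t)).
Qed.

(** The one-dimensional formula along the segment from a to a + v. *)
Lemma taylor2_bump (eta : Rd -> R) (a v : Rd) : bump_alg eta ->
  eta (a + v) - eta a - \sum_i v ord0 i * partial i eta a =
  \int[lebesgue_measure]_(t in `[0, 1]) ((1 - t) *
    \sum_i v ord0 i * \sum_j v ord0 j * partial j (partial i eta) (a + t *: v)).
Proof.
move=> be.
pose dd (t : R) := \sum_i v ord0 i * \sum_j v ord0 j * partial j (partial i eta) (a + t *: v).
have H : \int[lebesgue_measure]_(t in `[0, 1]) ((1 - t) * dd t) =
    eta (a + 1 *: v) - eta (a + 0 *: v)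
    - \sum_i v ord0 i * partial i eta (a + 0 *: v); last first.
  by rewrite H scale1r scale0r addr0.
apply: (@taylor2_integral (fun t => eta (a + t *: v))
  (fun t => \sum_i v ord0 i * partial i eta (a + t *: v)) dd).
- by move=> t; apply: is_derive_along; exact: bump_alg_differentiable.
- move=> t; set h := fun i s => v ord0 i * partial i eta (a + s *: v).
  rewrite (_ : (fun s : R => _) = \sum_(i < d) h i); last first.
    by apply/funext => s; rewrite fct_sumE.
  apply: is_derive_sum => i.
  have H := @is_deriveZ _ _ _ (fun s : R => partial i eta (a + s *: v)) (v ord0 i) t 1 _
    (is_derive_along (bump_alg_differentiable (bump_alg_partial i be) (a + t *: v))).
  exact: (is_derive_eq H).
- move=> t; apply: continuous_bigsum => i; apply: cvgM; first exact: cvg_cst.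
  apply: continuous_bigsum => j; apply: cvgM; first exact: cvg_cst.
  apply: (@continuous_comp _ _ _ (fun s : R => a + s *: v)
    (partial j (partial i eta))).
    apply: cvgD; first exact: cvg_cst.
    by apply: cvgZr_tmp; exact: cvg_id.
  apply/differentiable_continuous/bump_alg_differentiable.
  by do 2 apply: bump_alg_partial.
Qed.

End taylor.

(** * Taylor's formula for a mollified function with a weak Hessian *)

Section Rfubini.
Context d1 d2 (T1 : measurableType d1) (T2 : measurableType d2) (R : realType)
  (m1 : {sigma_finite_measure set T1 -> \bar R})
  (m2 : {sigma_finite_measure set T2 -> \bar R}).

Lemma Rintegral_indic_mul (mu : {measure set T1 -> \bar R}) (D : set T1) (g : T1 -> R) :
  \int[mu]_(t in D) g t = \int[mu]_t (\1_D t * g t).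
Proof.
rewrite Rintegral_mkcond; apply: eq_Rintegral => t _.
by rewrite patchE indicE; case: ifPn => _; rewrite ?mul1r ?mul0r.
Qed.

(** The integrability of every section, and not just of almost every one, lets
    the inner integrals be read as extended real ones throughout. *)
Lemma Rintegral_swap (F : T1 * T2 -> R) : (m1 \x m2)%E.-integrable setT (EFin \o F) ->
  (forall x, m2.-integrable setT (EFin \o (fun y => F (x, y)))) ->
  (forall y, m1.-integrable setT (EFin \o (fun x => F (x, y)))) ->
  \int[m1]_x \int[m2]_y F (x, y) = \int[m2]_y \int[m1]_x F (x, y).
Proof.
move=> iF i2 i1; rewrite /Rintegral; congr fine.
transitivity (\int[m1]_x \int[m2]_y (EFin \o F) (x, y))%E.
  by apply: eq_integral => x _; rewrite fineK//; exact: integrable_fin_num (i2 x).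
rewrite Fubini//.
apply: eq_integral => y _; rewrite fineK//; exact: integrable_fin_num (i1 y).
Qed.

End Rfubini.

Section unit_indicator.
Context {R : realType}.
Notation lambda := (@lebesgue_measure R).

(** Integrals over [0, 1] are written as integrals over the line weighted by
    this indicator, so that they are weighted averages of the same form as
    those against the kernel and the mollifier. *)
Definition I01 (t : R) : R := \1_(`[0, 1]%classic : set R) t.

Lemma measurable_I01 : measurable_fun setT I01.
Proof. exact: measurable_indic. Qed.

Lemma I01_ge0 t : 0 <= I01 t. Proof. by rewrite /I01 indicE. Qed.

Lemma I01_weight t : `|I01 t * (1 - t)| <= I01 t.
Proof.
rewrite /I01 indicE mem_setE in_itv/=.
have [/andP[t0 t1]|_] := boolP (_ && _); last by rewrite /= mul0r normr0.
by rewrite /= mul1r ger0_norm; lra.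
Qed.

Lemma integral_I01 : (\int[lambda]_t (I01 t)%:E = 1)%E.
Proof.
rewrite /I01 integral_indic// setIT.
by apply: (etrans (lebesgue_measure_itv `[0, 1])); rewrite /= lte_fin ltr01 -EFinB subr0.
Qed.

Lemma integrable_I01 : lambda.-integrable setT (EFin \o I01).
Proof. exact: integrable_indic_itv. Qed.

End unit_indicator.

Section mollified_taylor.
Context {R : realType} {d : nat}.
Notation Rd := 'rV[R]_d.
Notation lambda := (@lebesgue_measure R).

Lemma sqr_enorm (u : Rd) : enorm u ^+ 2 = \sum_i u ord0 i ^+ 2.
Proof. by rewrite /enorm sqr_sqrtr// sumr_ge0// => i _; exact: sqr_ge0. Qed.

Lemma coord_mul_le (u : Rd) i j : `|u ord0 i| * `|u ord0 j| <= enorm u ^+ 2.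
Proof.
rewrite expr2 ler_pM//; apply: le_trans (ler_coord_norm _ _) (norm_le_enorm _).
Qed.

Lemma measurable_shift_comp (g : Rd -> R) (z : Rd) : measurable_fun setT g ->
  measurable_fun setT (fun y : Rd => g (y - z)).
Proof. by move=> mg; meas. Qed.

(** The convolution of f with the reflection of eta.  With this sign a
    translate of eta is itself the test function in the definition of the weak
    Hessian, and derivatives in x become derivatives of eta up to sign. *)
Definition moll (f eta : Rd -> R) (x : Rd) : R := \int[leb d]_y (f y * eta (y - x)).

(** The version of [moll] for nonnegative functions that are not known to be
    integrable on bounded sets: the value may be infinite. *)
Definition emoll (g eta : Rd -> R) (x : Rd) : \bar R :=
  (\int[leb d]_y (g y * eta (y - x))%:E)%E.

Definition abs_entries (H : Rd -> 'M[R]_d) (x : Rd) : R := \sum_i \sum_j `|H x i j|.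

Variables (f : Rd -> R) (H : Rd -> 'M[R]_d) (r : R) (eta : Rd -> R).
Hypotheses (f_int : (leb d).-integrable setT (EFin \o f))
  (f_ge0 : forall x, 0 <= f x)
  (H_meas : forall i j, measurable_fun setT (fun x => H x i j))
  (H_weak : weak_hessian f H) (eta_moll : mollifier r eta).

Let mf : measurable_fun setT f.
Proof. by apply/measurable_EFinP; exact: measurable_int f_int. Qed.

Let beta : bump_alg eta. Proof. by case: eta_moll. Qed.

Lemma integrable_mul_bump (g : Rd -> R) (x : Rd) : bump_alg g ->
  (leb d).-integrable setT (EFin \o (fun y => f y * g (y - x))).
Proof.
move=> bg; have [C _ gC] := bump_alg_bounded bg.
apply: (integrable_mul_bounded (C := C)) => //.
exact: measurable_shift_comp (bump_alg_measurable bg).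
Qed.

(** The translate of eta is a test function. *)
Lemma weak_hessian_shift i j (z : Rd) :
  \int[leb d]_y (f y * partial i (partial j eta) (y - z)) =
  \int[leb d]_y (H y i j * eta (y - z)).
Proof.
have [_ eta0 _ out] := eta_moll.
have := @H_weak i j (fun y => eta (y - z)).
rewrite !partial_shift; apply.
apply: (@bump_alg_test_function _ _ (r + `|z|)); first exact: bump_alg_shift.
move=> x rx; apply: out; rewrite (lt_le_trans _ (lerB_dist _ _))//.
by rewrite ltrBrDr.
Qed.

Let abs_entries_ge0 x : 0 <= abs_entries H x.
Proof. by apply: sumr_ge0 => i _; apply: sumr_ge0. Qed.

Lemma measurable_abs_entries : measurable_fun setT (abs_entries H).
Proof.
apply: measurable_fun_bigsum => i; apply: measurable_fun_bigsum => j.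
exact: measurableT_comp (H_meas i j).
Qed.

(* The second directional derivative of eta. *)
Let hess2 (v : Rd) : Rd -> R := fun z =>
  \sum_i v ord0 i * \sum_j v ord0 j * partial j (partial i eta) z.

Let hess2_bump v : bump_alg (hess2 v).
Proof.
apply: bump_alg_sum => i; apply: bump_algM; first exact: bump_alg_cst.
apply: bump_alg_sum => j; apply: bump_algM; first exact: bump_alg_cst.
by do 2 apply: bump_alg_partial.
Qed.

(** The weak Hessian moves the two derivatives from eta onto f: the left-hand
    side is the quadratic form in v of the mollified H, and |v_i v_j| is at
    most the squared Euclidean norm of v. *)
Lemma hess2_weak (v z : Rd) :
  ((`| \int[leb d]_y (f y * hess2 v (y - z)) |)%:E <=
  (enorm v ^+ 2)%:E * emoll (abs_entries H) eta z)%E.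
Proof.
have [_ eta0 _ out] := eta_moll.
have mH := measurable_abs_entries.
have me := bump_alg_measurable beta.
have E : \int[leb d]_y (f y * hess2 v (y - z)) =
  \sum_i v ord0 i * \sum_j v ord0 j * \int[leb d]_y (H y j i * eta (y - z)).
  pose k i y := v ord0 i * (f y * \sum_j v ord0 j * partial j (partial i eta) (y - z)).
  have bi i : bump_alg (fun x => \sum_j v ord0 j * partial j (partial i eta) x).
    apply: bump_alg_sum => j; apply: bump_algM; first exact: bump_alg_cst.
    by do 2 apply: bump_alg_partial.
  have ki i : (leb d).-integrable setT (EFin \o k i).
    have := @integrableZl _ _ _ (leb d) setT measurableT (v ord0 i) _ (integrable_mul_bump z (bi i)).
    by apply: eq_integrable => // y _.
  rewrite (@eq_Rintegral _ _ _ (leb d) setT (fun y => \sum_i k i y)); last first.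
    move=> y _; rewrite /hess2 mulr_sumr; apply: eq_bigr => i _.
    by rewrite /k mulrCA.
  rewrite (Rintegral_sum _ ki).1; apply: eq_bigr => i _.
  rewrite /k RintegralZl//; last exact: (integrable_mul_bump z (bi i)).
  congr (_ * _).
  pose l j y := v ord0 j * (f y * partial j (partial i eta) (y - z)).
  have bj j : bump_alg (partial j (partial i eta)) by do 2 apply: bump_alg_partial.
  have li j : (leb d).-integrable setT (EFin \o l j).
    have := @integrableZl _ _ _ (leb d) setT measurableT (v ord0 j) _ (integrable_mul_bump z (bj j)).
    by apply: eq_integrable => // y _.
  rewrite (@eq_Rintegral _ _ _ (leb d) setT (fun y => \sum_j l j y)); last first.
    move=> y _; rewrite mulr_sumr; apply: eq_bigr => j _.
    by rewrite /l mulrCA.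
  rewrite (Rintegral_sum _ li).1; apply: eq_bigr => j _.
  rewrite /l RintegralZl//; last exact: (integrable_mul_bump z (bj j)).
  by congr (_ * _); exact: weak_hessian_shift.
have mHe i j : measurable_fun setT (fun y : Rd => H y j i * eta (y - z)).
  by apply: measurable_funM => //; exact: measurable_shift_comp.
rewrite E /emoll.
have -> : (\int[leb d]_y (abs_entries H y * eta (y - z))%:E =
    \sum_i \sum_j \int[leb d]_y (`|H y j i| * eta (y - z))%:E)%E.
  pose Q i j y := (`|H y j i| * eta (y - z))%:E.
  have mQ i j : measurable_fun setT (Q i j).
    apply/measurable_EFinP; apply: measurable_funM; last exact: measurable_shift_comp.
    exact: measurableT_comp.
  have Q0 i j y : (0 <= Q i j y)%E by rewrite lee_fin mulr_ge0.
  transitivity (\int[leb d]_y \sum_i \sum_j Q i j y)%E.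
    apply: eq_integral => y _; rewrite /abs_entries exchange_big mulr_suml -sumEFin.
    by apply: eq_bigr => i _; rewrite mulr_suml -sumEFin.
  rewrite ge0_integral_sum//; last 2 first.
  - by move=> i; exact: emeasurable_sum.
  - by move=> i y _; exact: sume_ge0.
  by apply: eq_bigr => i _; rewrite ge0_integral_sum.
rewrite ge0_sume_distrr; last first.
  by move=> i _; apply: sume_ge0 => j _; apply: integral_ge0 => y _; rewrite lee_fin mulr_ge0.
rewrite (le_trans (_ : _ <= (\sum_i `|v ord0 i * \sum_j v ord0 j * \int[leb d]_y (H y j i * eta (y - z))|)%:E)%E)//.
  by rewrite lee_fin ler_norm_sum.
rewrite -sumEFin; apply: lee_sum => i _.
rewrite ge0_sume_distrr; last first.
  by move=> j _; apply: integral_ge0 => y _; rewrite lee_fin mulr_ge0.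
rewrite mulr_sumr.
rewrite (le_trans (_ : _ <= (\sum_j `|v ord0 i * (v ord0 j * \int[leb d]_y (H y j i * eta (y - z)))|)%:E)%E)//.
  by rewrite lee_fin ler_norm_sum.
rewrite -sumEFin; apply: lee_sum => j _.
rewrite mulrA normrM EFinM; apply: lee_pmul => //.
  by rewrite lee_fin normrM coord_mul_le.
apply: le_trans (abs_Rintegral_le _ (mHe i j)) _.
rewrite le_eqVlt; apply/orP; left; apply/eqP; apply: eq_integral => y _.
by rewrite normrM (ger0_norm (eta0 _)).
Qed.

Lemma emoll_ge0 (z : Rd) : (0 <= emoll (abs_entries H) eta z)%E.
Proof.
have [_ eta0 _ _] := eta_moll.
by apply: integral_ge0 => y _; rewrite lee_fin mulr_ge0.
Qed.

Lemma measurable_emoll : measurable_fun setT (emoll (abs_entries H) eta).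
Proof.
have [_ eta0 _ _] := eta_moll.
have me := bump_alg_measurable beta.
have mH := measurable_abs_entries.
apply: (@measurable_eintegral_param R _ _ Rd Rd (leb d)
  (fun p => (abs_entries H p.2 * eta (p.2 - p.1))%:E)); last first.
  by move=> p; rewrite lee_fin mulr_ge0.
by meas.
Qed.

(* Local names, through which [meas] and [//] find these facts. *)
Let m01 := @measurable_I01 R.
Let I010 := @I01_ge0 R.

(* The Taylor remainder of the mollified function, as a function of the
   variables y and t over which it is integrated. *)
Let F (x v : Rd) (p : Rd * R) : R :=
  f p.1 * (I01 p.2 * (1 - p.2) * hess2 v (p.1 - (x - p.2 *: v))).

Let measurable_F x v : measurable_fun setT (F x v).
Proof.
have mh := bump_alg_measurable (hess2_bump v).
by rewrite /F; meas.
Qed.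

Let F_bound v : exists2 C, 0 <= C & forall x p, `|F x v p| <= f p.1 * (C * I01 p.2).
Proof.
have [C C0 hC] := bump_alg_bounded (hess2_bump v); exists C => // x p.
rewrite /F normrM ger0_norm// ler_wpM2l// normrM [leRHS]mulrC.
by apply: ler_pM => //; exact: I01_weight.
Qed.

Let integrable_F x v : (leb d \x lambda)%E.-integrable setT (EFin \o F x v).
Proof.
have [C C0 FC] := F_bound v.
apply/integrable12ltyP; first by apply/measurable_EFinP; exact: measurable_F.
apply: (@le_lt_trans _ _ (\int[leb d]_y \int[lambda]_t (f y * (C * I01 t))%:E)%E).
  apply: ge0_le_integral => //=.
  - by move=> y _; apply: integral_ge0 => t _; rewrite lee_fin.
  - apply: (measurable_eintegral_param lambda (F := fun p => (`|F x v p|)%:E)) => //.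
    by apply/measurable_EFinP; apply: measurableT_comp => //; exact: measurable_F.
  - apply: (measurable_eintegral_param lambda (F := fun p => (f p.1 * (C * I01 p.2))%:E)).
      by meas.
    by move=> p; rewrite lee_fin !mulr_ge0.
  - move=> y _; apply: ge0_le_integral => //=.
    + apply/measurable_EFinP; apply: measurableT_comp => //.
      exact: (measurableT_comp (measurable_F x v) (pair1_measurable y)).
    + by meas.
    + by move=> t _; rewrite lee_fin; exact: FC.
have -> : (\int[leb d]_y \int[lambda]_t (f y * (C * I01 t))%:E =
           \int[leb d]_y ((f y)%:E * C%:E))%E.
  apply: eq_integral => y _.
  under eq_integral do rewrite mulrA EFinM.
  rewrite ge0_integralZl//; last 3 first.
  - exact/measurable_EFinP.
  - by move=> t _; rewrite lee_fin.
  - by rewrite lee_fin mulr_ge0.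
  by rewrite integral_I01 mule1 EFinM.
rewrite ge0_integralZr//; last 2 first.
- exact/measurable_EFinP.
- by move=> y _; rewrite lee_fin.
apply: lte_mul_pinfty => //; first by apply: integral_ge0 => y _; rewrite lee_fin.
  exact: integrable_fin_num f_int.
exact: ltry.
Qed.

Let integrable_F1 x v y : lambda.-integrable setT (EFin \o (fun t => F x v (y, t))).
Proof.
have [C C0 FC] := F_bound v.
apply: (@le_integrableR _ _ R lambda (fun t => F x v (y, t)) (fun t => f y * C * I01 t)).
- exact: (measurableT_comp (measurable_F x v) (pair1_measurable y)).
- by move=> t; rewrite -mulrA; exact: FC.
have := @integrableZl _ _ _ lambda setT measurableT (f y * C) _ integrable_I01.
by apply: eq_integrable.
Qed.

Let integrable_F2 x v t : (leb d).-integrable setT (EFin \o (fun y => F x v (y, t))).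
Proof.
have [C C0 FC] := F_bound v.
apply: (@le_integrableR _ _ R (leb d) (fun y => F x v (y, t)) (fun y => C * I01 t * f y)).
- exact: (measurableT_comp (measurable_F x v) (pair2_measurable t)).
- by move=> y; rewrite [leRHS]mulrC; exact: FC.
have := @integrableZl _ _ _ (leb d) setT measurableT (C * I01 t) _ f_int.
by apply: eq_integrable.
Qed.

(** Taylor's formula for eta between y - x and y - x + v, integrated in y
    against f. *)
Lemma moll_taylor (x v : Rd) :
  moll f eta (x - v) - moll f eta x
    - \sum_i v ord0 i * moll f (partial i eta) x =
  \int[leb d]_y \int[lambda]_t F x v (y, t).
Proof.
pose k i y := v ord0 i * (f y * partial i eta (y - x)).
have ki i : (leb d).-integrable setT (EFin \o k i).
  have := @integrableZl _ _ _ (leb d) setT measurableT (v ord0 i) _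
    (integrable_mul_bump x (bump_alg_partial i beta)).
  by apply: eq_integrable.
have -> : \sum_i v ord0 i * moll f (partial i eta) x = \int[leb d]_y \sum_i k i y.
  rewrite (Rintegral_sum _ ki).1; apply: eq_bigr => i _.
  by rewrite /k RintegralZl//; exact: (integrable_mul_bump x (bump_alg_partial i beta)).
rewrite /moll -RintegralB//; [|exact: integrable_mul_bump..].
rewrite -RintegralB//; last 2 first.
- have := integrableB measurableT (integrable_mul_bump (x - v) beta)
    (integrable_mul_bump x beta).
  by apply: eq_integrable.
- exact: (Rintegral_sum _ ki).2.
apply: eq_Rintegral => y _.
have -> : f y * eta (y - (x - v)) - f y * eta (y - x) - \sum_i k i y =
    f y * (eta ((y - x) + v) - eta (y - x) - \sum_i v ord0 i * partial i eta (y - x)).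
  rewrite opprB addrCA addrA [v + _]addrC addrAC mulrBr mulrBr mulr_sumr.
  by congr (_ - _); apply: eq_bigr => i _; rewrite /k mulrCA.
rewrite taylor2_bump// Rintegral_indic_mul -RintegralZl//.
  apply: eq_Rintegral => t _.
  rewrite /F /= (_ : y - (x - t *: v) = y - x + t *: v).
    by rewrite -[in RHS]mulrA.
  by rewrite opprB addrCA [_ *: v + _]addrC.
have [C C0 hC] := bump_alg_bounded (hess2_bump v).
have mh := bump_alg_measurable (hess2_bump v).
apply: (@le_integrableR _ _ R lambda
  (fun t => I01 t * ((1 - t) * hess2 v ((y - x) + t *: v))) (fun t => C * I01 t)).
- by meas.
- move=> t; rewrite mulrA normrM [leRHS]mulrC; apply: ler_pM => //; exact: I01_weight.
have := @integrableZl _ _ _ lambda setT measurableT C _ integrable_I01.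
by apply: eq_integrable.
Qed.

(** Exchanging the integrals over y and t leaves, for each t, the second
    derivative of the mollified function at x - tv, to which the weak Hessian
    applies; the factor 1 - t is bounded by 1. *)
Lemma moll_taylor_bound (x v : Rd) :
  ((`|moll f eta (x - v) - moll f eta x
      - \sum_i v ord0 i * moll f (partial i eta) x|)%:E <=
   (enorm v ^+ 2)%:E * \int[lambda]_t
     ((I01 t)%:E * emoll (abs_entries H) eta (x - t *: v)%R))%E.
Proof.
have me := measurable_emoll.
have mem : measurable_fun setT (fun t : R =>
    (I01 t)%:E * emoll (abs_entries H) eta (x - t *: v))%E by meas.
rewrite moll_taylor Rintegral_swap//.
apply: le_trans (abs_Rintegral_le _ _) _.
  apply: (measurable_integral_param (leb d) (F := fun p => F x v (p.2, p.1))).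
  by apply: (measurableT_comp (measurable_F x v)); meas.
rewrite -ge0_integralZl//; last 2 first.
- by move=> t _; rewrite mule_ge0// ?lee_fin//; exact: emoll_ge0.
- by rewrite lee_fin sqr_ge0.
- apply: ge0_le_integral => //=.
  + apply/measurable_EFinP; apply: measurableT_comp => //.
    apply: (measurable_integral_param (leb d) (F := fun p => F x v (p.2, p.1))).
    by apply: (measurableT_comp (measurable_F x v)); meas.
  + exact: emeasurable_funM.
  + move=> t _.
    have -> : \int[leb d]_y F x v (y, t) =
      I01 t * (1 - t) * \int[leb d]_y (f y * hess2 v (y - (x - t *: v))).
      rewrite -RintegralZl//; last exact: (integrable_mul_bump _ (hess2_bump v)).
      by apply: eq_Rintegral => y _; rewrite /F /= mulrCA.
    rewrite normrM EFinM muleCA; apply: lee_pmul => //; first by rewrite lee_fin; exact: I01_weight.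
    exact: hess2_weak.
Qed.

End mollified_taylor.

(** * L2 norms of weighted averages *)

Section averaging.
Local Open Scope ereal_scope.
Context d1 d2 (S : measurableType d1) (T : measurableType d2) (R : realType)
  (nu : {sigma_finite_measure set S -> \bar R})
  (mu : {sigma_finite_measure set T -> \bar R}).

Lemma mul_le_halves_sq (a w : R) (g : \bar R) : (0 <= a)%R -> (0 <= w)%R -> 0 <= g ->
  (2 * a)%:E * (w%:E * g) <= (a ^+ 2)%:E * w%:E + w%:E * (g * g).
Proof.
move=> a0 w0; case: g => [g|_|//].
  by rewrite lee_fin => g0; rewrite -!EFinM -EFinD lee_fin;
    have := sqr_ge0 (a - g)%R; nra.
have [->|wn0] := eqVneq w 0%R; first by rewrite !mul0e !mule0 adde0.
have w_gt0 : (0 < w)%R by rewrite lt_neqAle eq_sym wn0.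
rewrite mulyy (@gt0_muley _ w%:E)// addey ?leey//.
Qed.

(** Cauchy-Schwarz.  The integrals may be infinite and W only bounds the mass of
    w, so the usual proof is done by hand: writing I for the integral of w g
    and Q for that of w g^2, integrate 2 a g <= a^2 + g^2 against w to get
    2 a I <= a^2 W + Q, and take the optimal a = I / W once I is known to be
    finite (which is the case a = 1). *)
Lemma jensen_sq (w : S -> R) (g : S -> \bar R) (W : R) :
  measurable_fun setT w -> (forall s, 0 <= w s)%R ->
  measurable_fun setT g -> (forall s, 0 <= g s) ->
  (0 < W)%R -> \int[nu]_s (w s)%:E <= W%:E ->
  (\int[nu]_s ((w s)%:E * g s)) * (\int[nu]_s ((w s)%:E * g s)) <=
  W%:E * \int[nu]_s ((w s)%:E * (g s * g s)).
Proof.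
move=> mw w0 mg g0 W0 wW.
set I := \int[nu]_s _; set Q := \int[nu]_s ((w s)%:E * (g s * g s)).
have mwE : measurable_fun setT (EFin \o w) by exact/measurable_EFinP.
have I0 : 0 <= I by apply: integral_ge0 => s _; rewrite mule_ge0 ?lee_fin.
have Q0 : 0 <= Q by apply: integral_ge0 => s _; rewrite !mule_ge0 ?lee_fin.
have key (a : R) : (0 <= a)%R -> (2 * a)%:E * I <= (a ^+ 2)%:E * W%:E + Q.
  move=> a0.
  rewrite (@le_trans _ _ ((a ^+ 2)%:E * \int[nu]_s (w s)%:E + Q))//; last first.
    by rewrite leeD2r// lee_wpmul2l// lee_fin sqr_ge0.
  have mwg : measurable_fun setT (fun s => (w s)%:E * g s) by exact: emeasurable_funM.
  have mwgg : measurable_fun setT (fun s => (w s)%:E * (g s * g s)).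
    by do 2 apply: emeasurable_funM => //.
  have -> : (2 * a)%:E * I = \int[nu]_s ((2 * a)%:E * ((w s)%:E * g s)).
    rewrite ge0_integralZl// ?lee_fin ?mulr_ge0//.
    by move=> s _; rewrite mule_ge0 ?lee_fin.
  have -> : (a ^+ 2)%:E * \int[nu]_s (w s)%:E = \int[nu]_s ((a ^+ 2)%:E * (w s)%:E).
    rewrite ge0_integralZl// ?lee_fin ?sqr_ge0//.
    by move=> s _; rewrite lee_fin.
  rewrite /Q -ge0_integralD//; first last.
  - by move=> s _; rewrite !mule_ge0 ?lee_fin.
  - exact: emeasurable_funM.
  - by move=> s _; rewrite mule_ge0 ?lee_fin ?sqr_ge0.
  apply: ge0_le_integral => //.
  - by move=> s _; rewrite !mule_ge0 ?lee_fin ?mulr_ge0.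
  - by do 2 apply: emeasurable_funM => //.
  - apply: emeasurable_funD; first exact: emeasurable_funM.
    by do 2 apply: emeasurable_funM => //.
  - by move=> s _; exact: mul_le_halves_sq.
have [Qoo|Qfin] := eqVneq Q +oo.
  by rewrite Qoo gt0_muley ?lte_fin// leey.
have QE : Q = (fine Q)%:E by rewrite fineK// ge0_fin_numE// ltey.
have Ifin : I \is a fin_num.
  have := key 1%R ler01; rewrite QE -EFinM -EFinD.
  case: (I) I0 => // _; rewrite gt0_muley ?lte_fin//.
have IE : I = (fine I)%:E by rewrite fineK.
have i0 : (0 <= fine I)%R by exact: fine_ge0.
have := key (fine I / W)%R (divr_ge0 i0 (ltW W0)).
rewrite IE QE -!EFinM -!EFinD !lee_fin => h.
have : (W * (2 * (fine I / W) * fine I) <= W * ((fine I / W) ^+ 2 * W + fine Q))%R.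
  by rewrite ler_wpM2l// ltW.
have -> : (W * (2 * (fine I / W) * fine I) = 2 * (fine I * fine I))%R.
  by field; rewrite gt_eqF.
have -> : (W * ((fine I / W) ^+ 2 * W + fine Q) = fine I * fine I + W * fine Q)%R.
  by field; rewrite gt_eqF.
lra.
Qed.

(** [jensen_sq] for each x, then Tonelli to integrate in x first. *)
Lemma averaging_sq (w : S -> R) (G : S * T -> \bar R) (W : R) (M : \bar R) : 0 <= M ->
  measurable_fun setT w -> (forall s, 0 <= w s)%R ->
  measurable_fun setT G -> (forall p, 0 <= G p) ->
  (0 < W)%R -> \int[nu]_s (w s)%:E <= W%:E ->
  (forall s, \int[mu]_x (G (s, x) * G (s, x)) <= M) ->
  \int[mu]_x ((\int[nu]_s ((w s)%:E * G (s, x))) * (\int[nu]_s ((w s)%:E * G (s, x)))) <=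
  (W ^+ 2)%:E * M.
Proof.
move=> M0 mw w0 mG G0 W0 wW GM.
have mwE : measurable_fun setT (EFin \o w) by exact/measurable_EFinP.
have mGs x : measurable_fun setT (fun s => G (s, x)) by exact: measurableT_comp (pair2_measurable x).
have mGx s : measurable_fun setT (fun x => G (s, x)) by exact: measurableT_comp (pair1_measurable s).
have mw1 : measurable_fun setT (fun p : T * S => (w p.2)%:E).
  exact: (measurableT_comp mwE measurable_snd).
have mG1 : measurable_fun setT (fun p : T * S => G (p.2, p.1)) by meas.
have mI : measurable_fun setT (fun x => \int[nu]_s ((w s)%:E * G (s, x))).
  apply: (measurable_eintegral_param nu (F := fun p => (w p.2)%:E * G (p.2, p.1))).
    exact: emeasurable_funM.
  by move=> p; rewrite mule_ge0 ?lee_fin.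
have I0 x : 0 <= \int[nu]_s ((w s)%:E * G (s, x)).
  by apply: integral_ge0 => s _; rewrite mule_ge0 ?lee_fin.
apply: (@le_trans _ _ (\int[mu]_x (W%:E * \int[nu]_s ((w s)%:E * (G (s, x) * G (s, x)))))).
  apply: ge0_le_integral => //.
  - by move=> x _; exact: mule_ge0.
  - exact: emeasurable_funM.
  - apply: emeasurable_funM => //.
    apply: (measurable_eintegral_param nu (F := fun p => (w p.2)%:E * (G (p.2, p.1) * G (p.2, p.1)))).
      by do 2 apply: emeasurable_funM => //.
    by move=> p; rewrite !mule_ge0 ?lee_fin.
  - by move=> x _; exact: jensen_sq.
rewrite ge0_integralZl//; last 3 first.
- apply: (measurable_eintegral_param nu (F := fun p => (w p.2)%:E * (G (p.2, p.1) * G (p.2, p.1)))).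
    by do 2 apply: emeasurable_funM => //.
  by move=> p; rewrite !mule_ge0 ?lee_fin.
- by move=> x _; apply: integral_ge0 => s _; rewrite !mule_ge0 ?lee_fin.
- by rewrite lee_fin ltW.
rewrite expr2 EFinM -muleA lee_wpmul2l ?lee_fin ?(ltW W0)//.
rewrite (fubini_tonelli (fun p : T * S => (w p.2)%:E * (G (p.2, p.1) * G (p.2, p.1))))//; last 2 first.
- by do 2 apply: emeasurable_funM => //.
- by move=> p; rewrite !mule_ge0 ?lee_fin.
apply: (@le_trans _ _ (\int[nu]_s ((w s)%:E * M))).
  apply: ge0_le_integral => //=.
  - by move=> s _; apply: integral_ge0 => x _; rewrite !mule_ge0 ?lee_fin.
  - apply: (measurable_eintegral_param mu (F := fun p => (w p.1)%:E * (G p * G p))).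
      apply: emeasurable_funM; last exact: emeasurable_funM.
      exact: (measurableT_comp mwE measurable_fst).
    by move=> p; rewrite !mule_ge0 ?lee_fin.
  - exact: emeasurable_funM.
  - move=> s _; rewrite ge0_integralZl//.
    + by rewrite lee_wpmul2l ?lee_fin.
    + exact: emeasurable_funM.
    + by move=> x _; rewrite mule_ge0.
    + by rewrite lee_fin.
rewrite ge0_integralZr//; last by move=> s _; rewrite lee_fin.
by rewrite lee_wpmul2r.
Qed.

End averaging.

(** * Bias of a mollified function *)

Section mollified_bias.
Context {R : realType} {d : nat}.
Notation Rd := 'rV[R]_d.
Notation lambda := (@lebesgue_measure R).

Lemma ge0_integral_leb_shift (b : Rd) (F : Rd -> \bar R) :
  measurable_fun setT F -> (forall x, 0 <= F x)%E ->
  (\int[leb d]_x F (x + b)%R = \int[leb d]_x F x)%E.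
Proof.
move=> mF F0; rewrite [RHS](@ge0_integral_leb_affine _ d 1 b)//.
rewrite normr1 expr1n mul1e; apply: eq_integral => x _.
by rewrite scale1r.
Qed.

Variables (f K : Rd -> R) (H : Rd -> 'M[R]_d) (r : R) (eta : Rd -> R).
Hypotheses (f_int : (leb d).-integrable setT (EFin \o f))
  (f_ge0 : forall x, 0 <= f x)
  (H_meas : forall i j, measurable_fun setT (fun x => H x i j))
  (H_weak : weak_hessian f H) (eta_moll : mollifier r eta).
Hypotheses (K_int : (leb d).-integrable setT (EFin \o K))
  (K_mean0 : forall i, \int[leb d]_u (u ord0 i * K u) = 0)
  (K_moment2 : (\int[leb d]_u (enorm u ^+ 2 * `|K u|)%:E < +oo)%E).

Let mf : measurable_fun setT f.
Proof. by apply/measurable_EFinP; exact: measurable_int f_int. Qed.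

Let mK : measurable_fun setT K.
Proof. by apply/measurable_EFinP; exact: measurable_int K_int. Qed.

Let beta : bump_alg eta. Proof. by case: eta_moll. Qed.

Let me : measurable_fun setT eta.
Proof. exact: bump_alg_measurable. Qed.

Let eta_ge0 x : 0 <= eta x. Proof. by case: eta_moll. Qed.

Let abs_entries_ge0 x : 0 <= abs_entries H x.
Proof. by apply: sumr_ge0 => i _; apply: sumr_ge0. Qed.

Lemma measurable_enorm : measurable_fun setT (@enorm R d).
Proof.
have mS := continuous_measurable_fun (@sqrt_continuous R).
apply: (measurableT_comp mS).
by apply: measurable_fun_bigsum => i; apply: measurable_funX; exact: measurable_rVcoord.
Qed.

Lemma integrable_moment2 : (leb d).-integrable setT (EFin \o (fun u => enorm u ^+ 2 * `|K u|)).
Proof.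
apply/integrableP; split.
  have me2 := measurable_enorm.
  by meas.
rewrite (eq_integral (fun u => (enorm u ^+ 2 * `|K u|)%:E)%E)//.
by move=> u _; rewrite gee0_abs// lee_fin mulr_ge0// sqr_ge0.
Qed.

Lemma integrable_moment1 i : (leb d).-integrable setT (EFin \o (fun u : Rd => u ord0 i * K u)).
Proof.
apply: (@le_integrableR _ _ R (leb d) _ (fun u => `|K u| + enorm u ^+ 2 * `|K u|)).
- by apply: measurable_funM => //; exact: measurable_rVcoord.
- move=> u; rewrite normrM -[X in X + _]mul1r -mulrDl ler_wpM2r//.
  by have := coord_mul_le u i i; have := normr_ge0 (u ord0 i); nra.
have := integrableD measurableT (integrable_norm K_int) integrable_moment2.
by apply: eq_integrable.
Qed.

Lemma moll_bounded : exists C, forall x, `|moll f eta x| <= C.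
Proof.
have [C C0 hC] := bump_alg_bounded beta.
exists (C * fine (\int[leb d]_x (f x)%:E)%E) => x.
have fi : (leb d).-integrable setT (EFin \o f) := f_int.
rewrite -lee_fin; apply: le_trans (abs_Rintegral_le _ _) _; first by meas.
rewrite EFinM fineK; last exact: integrable_fin_num f_int.
rewrite -ge0_integralZl//; last 2 first.
- exact/measurable_EFinP.
- by move=> y _; rewrite lee_fin.
- apply: ge0_le_integral => //.
  + by apply/measurable_EFinP; meas.
  + by apply: emeasurable_funM => //; exact/measurable_EFinP.
  + by move=> y _; rewrite -EFinM lee_fin normrM mulrC (ger0_norm (f_ge0 y)) ler_wpM2r.
Qed.

Lemma measurable_moll (g : Rd -> R) : measurable_fun setT g ->
  measurable_fun setT (moll f g).
Proof.
move=> mg; apply: (@measurable_integral_param R _ _ Rd Rd (leb d)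
  (fun p => f p.2 * g (p.2 - p.1))).
by meas.
Qed.

(** When g is the density of the sample, this is the bias at x of the kernel
    estimator with bandwidth h. *)
Definition kbias (g : Rd -> R) (h : R) (x : Rd) : R :=
  \int[leb d]_u (K u * (g (x - h *: u) - g x)).

Let m01 := @measurable_I01 R.
Let I010 := @I01_ge0 R.

(* The average over t of the mollified size of H, at the pair (u, x). *)
Let G (h : R) (p : Rd * Rd) : \bar R := (\int[lambda]_t
     ((I01 t)%:E *
       emoll (abs_entries H) eta (p.2 - t *: (h *: p.1))%R))%E.

Let emoll0 z : (0 <= emoll (abs_entries H) eta z)%E.
Proof. exact: (emoll_ge0 H eta_moll). Qed.

Let memoll : measurable_fun setT (emoll (abs_entries H) eta).
Proof. exact: (measurable_emoll H_meas eta_moll). Qed.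

Let G_ge0 h p : (0 <= G h p)%E.
Proof. by apply: integral_ge0 => t _; rewrite mule_ge0 ?lee_fin. Qed.

Let measurable_G h : measurable_fun setT (G h).
Proof.
apply: (@measurable_eintegral_param R _ _ (Rd * Rd)%type (measurableTypeR R) lambda
  (fun q => ((I01 q.2)%:E *
       emoll (abs_entries H) eta (q.1.2 - q.2 *: (h *: q.1.1))%R)%E)).
  by meas.
by move=> q; rewrite mule_ge0 ?lee_fin.
Qed.

(** The first-order Taylor term is linear in u, so its integral against K
    vanishes and it may be subtracted under the integral sign. *)
Lemma kbias_moll_bound h x :
  ((`|kbias (moll f eta) h x|)%:E <=
   (h ^+ 2)%:E * \int[leb d]_u ((enorm u ^+ 2 * `|K u|)%:E * G h (u, x)))%E.
Proof.
have [C hC] := moll_bounded.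
have me2 := measurable_enorm.
have mm := measurable_moll me.
pose c i := h * moll f (partial i eta) x.
pose Z i (u : Rd) := c i * (u ord0 i * K u).
have Zi i : (leb d).-integrable setT (EFin \o Z i).
  have := @integrableZl _ _ _ (leb d) setT measurableT (c i) _ (integrable_moment1 i).
  by apply: eq_integrable.
have [Z0 Zint] := Rintegral_sum (index_enum 'I_d) Zi.
have {}Z0 : \int[leb d]_u (\sum_i Z i u) = 0.
  rewrite Z0 big1// => i _; rewrite /Z RintegralZl//; last exact: integrable_moment1.
  by rewrite K_mean0 mulr0.
pose T (u : Rd) := moll f eta (x - h *: u) - moll f eta x
    - \sum_i (h *: u) ord0 i * moll f (partial i eta) x.
have mT : measurable_fun setT T by rewrite /T; meas.
have -> : kbias (moll f eta) h x = \int[leb d]_u (K u * T u).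
  rewrite /kbias -[LHS]subr0 -Z0 -RintegralB//.
    apply: eq_Rintegral => u _; rewrite /T [in RHS]mulrBr; congr (_ - _).
    by rewrite mulr_sumr; apply: eq_bigr => i _; rewrite /Z /c mxE; ring.
  apply: (integrable_mul_bounded (C := C + C)) => //; first by meas.
  by move=> u; rewrite (le_trans (ler_normB _ _))// lerD.
apply: le_trans (abs_Rintegral_le _ _) _; first by meas.
have Gm := measurable_G h.
have mu : measurable_fun setT (fun u => G h (u, x)) by meas.
have mint : measurable_fun setT (fun u => (enorm u ^+ 2 * `|K u|)%:E * G h (u, x))%E.
  by meas.
have int0 u : (0 <= (enorm u ^+ 2 * `|K u|)%:E * G h (u, x))%E.
  by apply: mule_ge0; [rewrite lee_fin mulr_ge0 ?sqr_ge0|exact: G_ge0].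
rewrite -(@ge0_integralZl _ _ _ (leb d) setT measurableT _ mint (h ^+ 2)%:E (fun u _ => int0 u)).
  2: by rewrite lee_fin sqr_ge0.
apply: ge0_le_integral => //.
- by apply/measurable_EFinP; meas.
- exact: emeasurable_funM.
- move=> u _; rewrite normrM EFinM.
  have -> : ((h ^+ 2)%:E * ((enorm u ^+ 2 * `|K u|)%:E * G h (u, x)) =
     `|K u|%:E * ((enorm (h *: u) ^+ 2)%:E * G h (u, x)))%E.
    rewrite !muleA -!EFinM; congr (_%:E * _)%E.
    rewrite !sqr_enorm; under [in RHS]eq_bigr do rewrite mxE exprMn.
    by rewrite -mulr_sumr; ring.
  rewrite lee_wpmul2l ?lee_fin//.
  exact: (moll_taylor_bound f_int f_ge0 H_meas H_weak eta_moll).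
Qed.

Let M := (\int[leb d]_x (abs_entries H x ^+ 2)%:E)%E.

(** Substituting y = s + z shows that [emoll] is an average of translates with
    the weight eta, of mass 1. *)
Lemma emoll_L2 : (\int[leb d]_x (emoll (abs_entries H) eta x * emoll (abs_entries H) eta x) <= M)%E.
Proof.
have mH := measurable_abs_entries H_meas.
have -> : emoll (abs_entries H) eta = (fun z => \int[leb d]_s ((eta s)%:E * (abs_entries H (s + z)%R)%:E))%E.
  apply/funext => z; rewrite /emoll -[LHS](ge0_integral_leb_shift z); last 2 first.
  - by meas.
  - by move=> y; rewrite lee_fin mulr_ge0.
  by apply: eq_integral => s _; rewrite addrK mulrC EFinM.
rewrite -[leRHS]mul1e -[X in X%:E](expr1n _ 2).
apply: (@averaging_sq _ _ Rd Rd R (leb d) (leb d) eta (fun p => (abs_entries H (p.1 + p.2)%R)%:E) 1) => //.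
- by apply: integral_ge0 => x _; rewrite lee_fin sqr_ge0.
- by meas.
- by move=> p; rewrite lee_fin.
- by case: eta_moll => _ _ ->.
- move=> s; rewrite /M -(ge0_integral_leb_shift s); last 2 first.
  + by meas.
  + by move=> y; rewrite lee_fin sqr_ge0.
  rewrite le_eqVlt; apply/orP; left; apply/eqP; apply: eq_integral => y _.
  by rewrite -EFinM addrC expr2.
Qed.

(** Three nested averages, over u (mass W), over t (mass 1) and, inside
    [emoll], over the mollifier (mass 1). *)
Lemma kbias_moll_L2 (h W : R) : 0 < W ->
  (\int[leb d]_u (enorm u ^+ 2 * `|K u|)%:E <= W%:E)%E ->
  (\int[leb d]_x (kbias (moll f eta) h x ^+ 2)%:E <= (h ^+ 4 * W ^+ 2)%:E * M)%E.
Proof.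
move=> W0 KW.
have me2 := measurable_enorm.
have mm := measurable_moll me.
have Gm := measurable_G h.
have M0 : (0 <= M)%E by apply: integral_ge0 => x _; rewrite lee_fin sqr_ge0.
pose I x := (\int[leb d]_u ((enorm u ^+ 2 * `|K u|)%:E * G h (u, x)))%E.
have I0 x : (0 <= I x)%E.
  apply: integral_ge0 => u _.
  by apply: mule_ge0; [rewrite lee_fin mulr_ge0 ?sqr_ge0|exact: G_ge0].
have mI : measurable_fun setT I.
  apply: (@measurable_eintegral_param R _ _ Rd Rd (leb d)
    (fun p => ((enorm p.2 ^+ 2 * `|K p.2|)%:E * G h (p.2, p.1))%E)).
    by meas.
  move=> p.
  by apply: mule_ge0; [rewrite lee_fin mulr_ge0 ?sqr_ge0|exact: G_ge0].
apply: (@le_trans _ _ (\int[leb d]_x ((h ^+ 4)%:E * (I x * I x)))%E).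
  apply: ge0_le_integral => //.
  - by move=> x _; rewrite lee_fin sqr_ge0.
  - apply/measurable_EFinP; apply: measurable_funX.
    apply: (@measurable_integral_param R _ _ Rd Rd (leb d)
      (fun p => K p.2 * (moll f eta (p.1 - h *: p.2) - moll f eta p.1))).
    by meas.
  - by do 2 apply: emeasurable_funM => //.
  - move=> x _; rewrite -(real_normK (num_real _)) expr2 EFinM.
    rewrite (_ : _ * (I x * I x) = ((h ^+ 2)%:E * I x) * ((h ^+ 2)%:E * I x))%E.
      by apply: lee_pmul; rewrite ?lee_fin//; exact: kbias_moll_bound.
    by rewrite muleACA -EFinM -exprD.
rewrite ge0_integralZl//; last 3 first.
- exact: emeasurable_funM.
- by move=> x _; exact: mule_ge0.
- by rewrite lee_fin exprn_even_ge0.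
rewrite (EFinM (h ^+ 4)) -muleA lee_wpmul2l ?lee_fin ?exprn_even_ge0//.
apply: (@averaging_sq _ _ Rd Rd R (leb d) (leb d) (fun u => enorm u ^+ 2 * `|K u|) (G h) W) => //.
- by meas.
- by move=> u; rewrite mulr_ge0 ?sqr_ge0.
move=> u; rewrite -[leRHS]mul1e -[X in X%:E](expr1n _ 2).
apply: (@averaging_sq _ _ (measurableTypeR R) Rd R lambda (leb d) I01
  (fun p => emoll (abs_entries H) eta (p.2 - p.1 *: (h *: u))) 1) => //.
- by meas.
- by rewrite integral_I01.
- move=> t /=; apply: le_trans emoll_L2; rewrite le_eqVlt; apply/orP; left; apply/eqP.
  apply: (ge0_integral_leb_shift (- (t *: (h *: u)))
    (F := fun z => (emoll (abs_entries H) eta z * emoll (abs_entries H) eta z)%E)).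
    exact: emeasurable_funM.
  by move=> z; exact: mule_ge0.
Qed.

End mollified_bias.

(** * Passing to the limit: L2 bound for the bias *)

Section fatou_sq.
Context d (T : measurableType d) (R : realType) (mu : {measure set T -> \bar R}).

Lemma fatou_sq (b_ : nat -> T -> R) (b : T -> R) (N : \bar R) :
  (forall k, measurable_fun setT (b_ k)) ->
  (forall x, b_ k x @[k --> \oo] --> b x) ->
  (forall k, (\int[mu]_x (b_ k x ^+ 2)%:E <= N)%E) ->
  (\int[mu]_x (b x ^+ 2)%:E <= N)%E.
Proof.
move=> mb cb bN.
pose g k x := (b_ k x ^+ 2)%:E.
have mg k : measurable_fun setT (g k) by apply/measurable_EFinP; exact: measurable_funX.
have g0 k x : setT x -> (0 <= g k x)%E by move=> _; rewrite lee_fin sqr_ge0.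
rewrite (eq_integral (fun x => limn_einf (g ^~ x))); last first.
  move=> x _; have gb : g k x @[k --> \oo] --> (b x ^+ 2)%:E.
    by apply: cvg_EFin; [exact: nearW|apply: cvgM; exact: cb].
  by rewrite (cvg_limn_einf_sup gb).1.
apply: le_trans (fatou mu measurableT mg g0) _.
rewrite limn_einf_lim; apply: lime_le; first exact: is_cvg_einfs.
apply: nearW => k; apply: le_trans (bN k).
by apply: ereal_inf_lbound; exists k => /=.
Qed.

End fatou_sq.

Section C11_growth.
Context {R : realType} {d : nat}.
Notation Rd := 'rV[R]_d.

(** The gradient grows at most linearly, and the mean value theorem applies on
    the segment from z to z + w.  Constants are lost in passing between the
    sup norm and the Euclidean norm. *)
Lemma C11_growth (f : Rd -> R) : C11 f -> exists A L : R, [/\ 0 <= A, 0 <= L &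
  forall z w, `|f (z + w) - f z| <= (A + L * (`|z| + `|w|)) * `|w|].
Proof.
move=> [df [L0 gL]].
pose L := `|L0| * d%:R.
have L_ge0 : 0 <= L by rewrite mulr_ge0.
have gi y i : `|partial i f y| <= `|partial i f 0| + L * `|y|.
  rewrite -lerBlDl (le_trans (lerB_dist _ _))//.
  have -> : partial i f y - partial i f 0 = (gradient f y - gradient f 0) ord0 i.
    by rewrite !mxE.
  apply: le_trans (ler_coord_norm _ _) _; apply: le_trans (norm_le_enorm _) _.
  apply: le_trans (gL _ _) _; rewrite subr0.
  rewrite (@le_trans _ _ (`|L0| * enorm y))//.
    by rewrite ler_wpM2r ?ler_norm// /enorm sqrtr_ge0.
  by rewrite /L -mulrA ler_wpM2l// enorm_le_norm.
exists (\sum_i `|partial i f 0|), (\sum_(i < d) L); split.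
- exact: sumr_ge0.
- exact: sumr_ge0.
move=> z w.
have dg (t : R) : is_derive t 1 (fun s : R => f (z + s *: w))
    (\sum_i w ord0 i * partial i f (z + t *: w)) by exact: is_derive_along.
have [|c c01] := @MVT R (fun s : R => f (z + s *: w)) _ 0 1 ltr01 (fun t _ => dg t).
  apply: continuous_subspaceT => t.
  apply/differentiable_continuous/derivable1_diffP.
  exact: (@ex_derive _ _ _ _ _ _ _ (dg t)).
rewrite scale1r scale0r addr0 subr0 mulr1 => ->.
rewrite (le_trans (ler_norm_sum _ _ _))// mulr_suml -big_split mulr_suml.
apply: ler_sum => i _; rewrite normrM mulrC ler_pM ?ler_coord_norm//.
rewrite (le_trans (gi _ _))// lerD2l ler_wpM2l//.
rewrite (le_trans (ler_normD _ _))// lerD2l normrZ.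
move: c01; rewrite in_itv/= => /andP[c0 c1].
by rewrite (ger0_norm (ltW c0)) ler_piMl// ltW.
Qed.

End C11_growth.

Section bias.
Context {R : realType} {d : nat}.
Notation Rd := 'rV[R]_d.

Variables (f K : Rd -> R) (H : Rd -> 'M[R]_d).
Hypotheses (f_int : (leb d).-integrable setT (EFin \o f))
  (f_ge0 : forall x, 0 <= f x) (f_C11 : C11 f)
  (H_meas : forall i j, measurable_fun setT (fun x => H x i j))
  (H_weak : weak_hessian f H).
Hypotheses (K_int : (leb d).-integrable setT (EFin \o K))
  (K_mean0 : forall i, \int[leb d]_u (u ord0 i * K u) = 0)
  (K_moment2 : (\int[leb d]_u (enorm u ^+ 2 * `|K u|)%:E < +oo)%E).

Let mf : measurable_fun setT f.
Proof. by apply/measurable_EFinP; exact: measurable_int f_int. Qed.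

Let mK : measurable_fun setT K.
Proof. by apply/measurable_EFinP; exact: measurable_int K_int. Qed.

Let me2 := @measurable_enorm R d.

Lemma integrable_quadratic_growth :
  (leb d).-integrable setT (EFin \o (fun u => `|K u| * (1 + enorm u ^+ 2))).
Proof.
have := integrableD measurableT (integrable_norm K_int) (integrable_moment2 K_int K_moment2).
apply: eq_integrable => // u _ /=.
by rewrite -EFinD mulrDr mulr1 [X in (_ + X)%:E]mulrC.
Qed.

Lemma norm_le_1Dsq (u : Rd) : `|u| <= 1 + enorm u ^+ 2.
Proof.
have := norm_le_enorm u; have := normr_ge0 u; have := sqr_ge0 (enorm u - 1).
by move=> *; nra.
Qed.

Lemma sq_norm_le (u : Rd) : `|u| ^+ 2 <= enorm u ^+ 2.
Proof. by rewrite lerXn2r ?nnegrE ?norm_le_enorm// /enorm sqrtr_ge0. Qed.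

Lemma integrable_kernel_shift (h : R) (x : Rd) :
  (leb d).-integrable setT (EFin \o (fun u => K u * f (x - h *: u))).
Proof.
have [A [L [A0 L0 AL]]] := C11_growth f_C11.
pose C := f x + (A + L * `|x|) * `|h| + L * `|h| ^+ 2.
have C0 : 0 <= C by rewrite !addr_ge0 ?mulr_ge0 ?addr_ge0 ?mulr_ge0.
apply: (@le_integrableR _ _ R (leb d) _ (fun u => C * (`|K u| * (1 + enorm u ^+ 2)))).
- by meas.
- move=> u; rewrite normrM mulrCA ler_wpM2l//.
  have h1 := norm_le_1Dsq u; have h2 := sq_norm_le u; have u0 := normr_ge0 u.
  have h0 := normr_ge0 h.
  have := AL x (- (h *: u)); rewrite normrN normrZ => hA.
  have : `|f (x - h *: u)| <= f x + (A + L * (`|x| + `|h| * `|u|)) * (`|h| * `|u|).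
    rewrite -[X in `|X|](subrK (f x)) (le_trans (ler_normD _ _))//.
    by rewrite (ger0_norm (f_ge0 x)) addrC lerD2l.
  move/le_trans; apply.
  have -> : f x + (A + L * (`|x| + `|h| * `|u|)) * (`|h| * `|u|) =
    f x + (A + L * `|x|) * `|h| * `|u| + L * `|h| ^+ 2 * `|u| ^+ 2 by ring.
  rewrite /C [leRHS]mulrDl [X in _ <= X + _]mulrDl; apply: lerD; first apply: lerD.
  + by rewrite ler_peMr// lerDl sqr_ge0.
  + by rewrite ler_wpM2l// !mulr_ge0 ?addr_ge0 ?mulr_ge0.
  + by rewrite ler_wpM2l ?mulr_ge0 ?sqr_ge0// (le_trans h2)// lerDr.
have := @integrableZl _ _ _ (leb d) setT measurableT C _ integrable_quadratic_growth.
by apply: eq_integrable.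
Qed.

Lemma integrable_mollifier (r : R) (eta : Rd -> R) (z : Rd) : mollifier r eta ->
  (leb d).-integrable setT (EFin \o (fun y => eta (y - z))) /\
  \int[leb d]_y eta (y - z) = 1.
Proof.
move=> [beta eta0 eta1 _].
have me : measurable_fun setT eta := bump_alg_measurable beta.
have I1 : (\int[leb d]_y (eta (y - z))%:E = 1)%E.
  rewrite -eta1; apply: (ge0_integral_leb_shift (- z) (F := EFin \o eta)).
    exact/measurable_EFinP.
  by move=> y; rewrite lee_fin.
split; last by rewrite /Rintegral I1.
apply/integrableP; split; first by meas.
rewrite (eq_integral (fun y : Rd => (eta (y - z))%:E)) ?I1 ?ltry//.
by move=> y _; rewrite /= ger0_norm.
Qed.

(** The difference is the integral of (f(y) - f(z)) eta(y - z), and |y - z| <= r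
    on the support of eta. *)
Lemma moll_close (r : R) (eta : Rd -> R) (A L : R) (z : Rd) : 0 <= r -> 0 <= A -> 0 <= L ->
  mollifier r eta ->
  (forall z w, `|f (z + w) - f z| <= (A + L * (`|z| + `|w|)) * `|w|) ->
  `|moll f eta z - f z| <= (A + L * (`|z| + r)) * r.
Proof.
move=> r0 A0 L0 me AL.
have [ieta eta1] := integrable_mollifier z me.
have [beta eta0 _ out] := me.
have meta : measurable_fun setT eta := bump_alg_measurable beta.
set B := (_ + _) * r.
have -> : moll f eta z - f z = \int[leb d]_y ((f y - f z) * eta (y - z)).
  rewrite /moll -[X in _ - X]mulr1 -eta1 -RintegralZl// -RintegralB//.
  - by apply: eq_Rintegral => y _; rewrite mulrBl.
  - exact: (integrable_mul_bump f_int z beta).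
  - have := @integrableZl _ _ _ (leb d) setT measurableT (f z) _ ieta.
    by apply: eq_integrable.
rewrite -lee_fin; apply: le_trans (abs_Rintegral_le _ _) _; first by meas.
rewrite (@le_trans _ _ (\int[leb d]_y (B * eta (y - z))%:E)%E)//; last first.
  under eq_integral do rewrite EFinM.
  rewrite integralZl//; move: eta1; rewrite /Rintegral => eta1.
  by rewrite -[X in (_ * X)%E]fineK ?eta1 ?mule1//; exact: integrable_fin_num ieta.
apply: ge0_le_integral => //.
- by meas.
- by meas.
move=> y _; rewrite lee_fin normrM (ger0_norm (eta0 _)).
have [yzr|yzr] := leP `|y - z| r; last by rewrite out// !mulr0.
rewrite ler_wpM2r//; have := AL z (y - z); rewrite [z + (y - z)]addrC subrK => /le_trans; apply.
apply: ler_pM => //; first by rewrite addr_ge0 ?mulr_ge0 ?addr_ge0.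
by rewrite lerD2l ler_wpM2l// lerD2l.
Qed.

(** By [moll_close] the two biases differ by at most 1/(k+1) times the integral
    of |K(u)| (1 + |u|^2), up to a constant depending on x and h. *)
Lemma kbias_moll_cvg (h : R) (eta_ : nat -> Rd -> R) :
  (forall k, mollifier (k.+1%:R^-1) (eta_ k)) ->
  forall x, kbias K (moll f (eta_ k)) h x @[k --> \oo] --> kbias K f h x.
Proof.
move=> eta_moll x.
have [A [L [A0 L0 AL]]] := C11_growth f_C11.
pose B (z : Rd) := A + L * (`|z| + 1).
have B0 z : 0 <= B z by rewrite addr_ge0 ?mulr_ge0 ?addr_ge0.
have close k z : `|moll f (eta_ k) z - f z| <= B z * k.+1%:R^-1.
  apply: le_trans (moll_close z _ A0 L0 (eta_moll k) AL) _ => //.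
  by rewrite ler_wpM2r// lerD2l ler_wpM2l// lerD2l invf_le1// ler1n.
(* B x + B (x - h u) <= 2 B x + L |h| |u|, and |u| <= 1 + |u|^2. *)
pose C := 2 * B x + L * `|h|.
pose J := \int[leb d]_u (C * (`|K u| * (1 + enorm u ^+ 2))).
have C0 : 0 <= C by rewrite addr_ge0 ?mulr_ge0.
have iC : (leb d).-integrable setT (EFin \o (fun u => C * (`|K u| * (1 + enorm u ^+ 2)))).
  have := @integrableZl _ _ _ (leb d) setT measurableT C _ integrable_quadratic_growth.
  by apply: eq_integrable.
have ifx : (leb d).-integrable setT (EFin \o (fun u => K u * f x)).
  have := @integrableZl _ _ _ (leb d) setT measurableT (f x) _ K_int.
  by apply: eq_integrable => // u _ /=; rewrite -EFinM mulrC.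
have i1 : (leb d).-integrable setT (EFin \o (fun u => K u * (f (x - h *: u) - f x))).
  have := integrableB measurableT (integrable_kernel_shift h x) ifx.
  by apply: eq_integrable => // u _ /=; rewrite -EFinB mulrBr.
have main k : `|kbias K f h x - kbias K (moll f (eta_ k)) h x| <= J * k.+1%:R^-1.
  have [M hM] := moll_bounded f_int f_ge0 (eta_moll k).
  have [beta _ _ _] := eta_moll k.
  have meta := bump_alg_measurable beta.
  have mm := measurable_moll f_int meta.
  have i2 : (leb d).-integrable setT
     (EFin \o (fun u => K u * (moll f (eta_ k) (x - h *: u) - moll f (eta_ k) x))).
    apply: (integrable_mul_bounded (C := M + M)) => //; first by meas.
    by move=> u; rewrite (le_trans (ler_normB _ _))// lerD.
  rewrite /kbias -RintegralB//.
  rewrite -lee_fin; apply: le_trans (abs_Rintegral_le _ _) _; first by meas.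
  have iJ := @integrableZl _ _ _ (leb d) setT measurableT k.+1%:R^-1 _ iC.
  rewrite mulrC /J -RintegralZl// /Rintegral fineK; last exact: integrable_fin_num iJ.
  apply: ge0_le_integral => //.
  - by meas.
  - by meas.
  move=> u _; rewrite lee_fin -mulrBr normrM.
  rewrite [leRHS](_ : _ = `|K u| * (k.+1%:R^-1 * (C * (1 + enorm u ^+ 2)))); last by ring.
  rewrite ler_wpM2l//.
  have -> : f (x - h *: u) - f x - (moll f (eta_ k) (x - h *: u) - moll f (eta_ k) x) =
     (moll f (eta_ k) x - f x) - (moll f (eta_ k) (x - h *: u) - f (x - h *: u)) by ring.
  apply: le_trans (ler_normB _ _) _.
  apply: le_trans (lerD (close k x) (close k (x - h *: u))) _.
  rewrite -mulrDl mulrC ler_wpM2l//.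
  have : `|x - h *: u| <= `|x| + `|h| * `|u|.
    by rewrite (le_trans (ler_normB _ _))// normrZ.
  move=> /(ler_wpM2l L0); have := norm_le_1Dsq u => hu.
  have h2 : L * `|h| * `|u| <= L * `|h| * (1 + enorm u ^+ 2) by rewrite ler_wpM2l ?mulr_ge0.
  have h3 : 0 <= B x * enorm u ^+ 2 by rewrite mulr_ge0 ?sqr_ge0.
  rewrite /C /B in h3 *; nra.
apply/cvgrPdist_le => e e0.
have J0 : 0 <= J by apply: Rintegral_ge0 => u _; rewrite mulr_ge0// mulr_ge0// addr_ge0 ?sqr_ge0.
have eJ : 0 < e / (J + 1) by rewrite divr_gt0// ltr_wpDl.
near=> k; apply: le_trans (main k) _.
have : k.+1%:R^-1 < e / (J + 1) :> R.
  near: k; exact: (@near_infty_natSinv_lt R (PosNum eJ)).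
rewrite ltr_pdivlMr ?ltr_wpDl// => /ltW; apply: le_trans.
by rewrite mulrC ler_wpM2l// lerDl.
Unshelve. all: by end_near.
Qed.

(** The bound for mollified functions is uniform in the mollifier, so it
    survives the pointwise limit by Fatou's lemma. *)
Theorem bias_L2 (h W : R) : 0 < W ->
  (\int[leb d]_u (enorm u ^+ 2 * `|K u|)%:E <= W%:E)%E ->
  (\int[leb d]_x (kbias K f h x ^+ 2)%:E <=
    (h ^+ 4 * W ^+ 2)%:E * \int[leb d]_x (abs_entries H x ^+ 2)%:E)%E.
Proof.
move=> W0 KW.
have ex k : exists eta : Rd -> R, mollifier k.+1%:R^-1 eta by apply: exists_mollifier.
have [eta_ eta_moll] := choice ex.
apply: (@fatou_sq _ _ _ _ (fun k => kbias K (moll f (eta_ k)) h)).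
- move=> k; have [beta _ _ _] := eta_moll k.
  have meta := bump_alg_measurable beta.
  have mm := measurable_moll f_int meta.
  apply: (@measurable_integral_param R _ _ Rd Rd (leb d)
      (fun p => K p.2 * (moll f (eta_ k) (p.1 - h *: p.2) - moll f (eta_ k) p.1))).
  by meas.
- exact: kbias_moll_cvg.
- move=> k; exact: (kbias_moll_L2 f_int f_ge0 H_meas H_weak (eta_moll k)).
Qed.

End bias.

(** * Laws with a density, independence and the mean of a sample *)

Section density.
Context d (T : measurableType d) (R : realType)
  (mu nu : {measure set T -> \bar R}) (f : T -> R).
Hypotheses (mf : measurable_fun setT f) (f0 : forall x, 0 <= f x)
  (nuE : forall A, measurable A -> nu A = (\int[mu]_(x in A) (f x)%:E)%E).
Local Open Scope ereal_scope.
Import HBNNSimple.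

Let mfE : measurable_fun setT (EFin \o f). Proof. exact/measurable_EFinP. Qed.

(** Both sides agree on indicators by hypothesis, hence on simple functions, and
    both are continuous along increasing sequences of these. *)
Lemma ge0_integral_density (g : T -> \bar R) : measurable_fun setT g ->
  (forall x, 0 <= g x) -> \int[nu]_x g x = \int[mu]_x (g x * (f x)%:E).
Proof.
move=> mg g0; pose g_ := nnsfun_approx measurableT mg.
have cg x : EFin (g_ n x) @[n --> \oo] --> g x by exact: cvg_nnsfun_approx.
have mg_ n : measurable_fun setT (EFin \o g_ n) by exact/measurable_EFinP/measurable_funP.
transitivity (limn (fun n => \int[nu]_x (g_ n x)%:E)).
  rewrite -monotone_convergence//.
  - by apply: eq_integral => y _; apply/esym/cvg_lim => //; exact: cg.
  - by move=> n y _; rewrite lee_fin.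
  - by move=> y _ m n mn; rewrite lee_fin; exact/lefP/nd_nnsfun_approx.
transitivity (limn (fun n => \int[mu]_x ((g_ n x)%:E * (f x)%:E))); last first.
  rewrite -monotone_convergence//.
  - apply: eq_integral => y _; apply/cvg_lim => //.
    by apply: cvgeZr => //; exact: cg.
  - by move=> n; apply: emeasurable_funM; [exact: mg_|exact: mfE].
  - by move=> n y _; rewrite mule_ge0// lee_fin.
  - move=> y _ m n mn; rewrite lee_wpmul2r ?lee_fin//.
    exact/lefP/nd_nnsfun_approx.
congr (limn _); apply/funext => n.
have mpre r : measurable (g_ n @^-1` [set r]) by rewrite -[X in measurable X]setTI; exact: (measurable_funP (g_ n)).
have mi r : measurable_fun setT (fun x => (\1_(g_ n @^-1` [set r]) x)%:E : \bar R).
  by apply/measurable_EFinP; exact: measurable_indic.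
have mif r : measurable_fun setT (fun x => (\1_(g_ n @^-1` [set r]) x)%:E * (f x)%:E).
  exact: emeasurable_funM.
have mri r : measurable_fun setT (fun x => (r * \1_(g_ n @^-1` [set r]) x)%:E).
  by apply/measurable_EFinP; apply: measurable_funM => //; exact: measurable_indic.
transitivity (\sum_(k \in range (g_ n)) \int[nu]_x (k * \1_(g_ n @^-1` [set k]) x)%:E).
  under eq_integral do rewrite fimfunE -fsumEFin//.
  rewrite ge0_integral_fsum//.
  - by move=> y x _; rewrite nnfun_muleindic_ge0.
transitivity (\sum_(k \in range (g_ n)) \int[mu]_x ((k * \1_(g_ n @^-1` [set k]) x)%:E * (f x)%:E)).
  apply: eq_fsbigr => r; rewrite inE => -[x _ rx].
  have r0 : (0 <= r)%R by rewrite -rx.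
  under eq_integral do rewrite EFinM.
  rewrite ge0_integralZl//.
  under [RHS]eq_integral do rewrite EFinM -muleA.
  rewrite [RHS]ge0_integralZl//; last by move=> y _; rewrite mule_ge0// lee_fin.
  rewrite integral_indic// setIT nuE//; congr (_ * _).
  rewrite integral_mkcond; apply: eq_integral => y _.
  by rewrite patchE indicE; case: ifPn; rewrite ?mul1e ?mul0e.
rewrite -ge0_integral_fsum//; last 2 first.
- by move=> r; exact: emeasurable_funM.
- by move=> r x _; rewrite mule_ge0 ?lee_fin//; exact: nnfun_muleindic_ge0.
apply: eq_integral => x _.
by rewrite [in RHS]fimfunE -fsumEFin// ge0_mule_fsuml// => r; exact: nnfun_muleindic_ge0.
Qed.

End density.

Section joint_law.
Context d1 d2 (Omega : measurableType d1) (S : measurableType d2) (R : realType)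
  (P : probability Omega R) (mu1 mu2 : {sigma_finite_measure set S -> \bar R})
  (Y Z : Omega -> S).
Hypotheses (mY : measurable_fun setT Y) (mZ : measurable_fun setT Z)
  (YZ_indep : forall A B, measurable A -> measurable B ->
    P (Y @^-1` A `&` Z @^-1` B) = (mu1 A * mu2 B)%E).

Let pairYZ w := (Y w, Z w).

Let mpair : measurable_fun setT pairYZ.
Proof. exact: measurable_fun_pair. Qed.

Let joint_lawE A : measurable A -> (mu1 \x mu2)%E A = pushforward P pairYZ A.
Proof.
have [J JE] : exists J : {measure set (S * S) -> \bar R},
    J = pushforward P pairYZ :> (_ -> _).
  by unshelve eexists; [refine (pushforward P pairYZ); exact: mpair|].
rewrite -JE; apply: product_measure_unique => B C mB mC.
by rewrite JE /pushforward; exact: YZ_indep.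
Qed.

(** Independence says that the law of (Y, Z) and the product measure agree on
    rectangles, which determines a product measure. *)
Lemma ge0_integral_joint (F : S * S -> \bar R) : measurable_fun setT F ->
  (forall p, 0 <= F p)%E ->
  (\int[P]_w F (Y w, Z w) = \int[mu1 \x mu2]_p F p)%E.
Proof.
move=> mF F0.
rewrite (@eq_measure_integral _ _ _ _ (pushforward P pairYZ)); last first.
  by move=> A mA _; exact: joint_lawE.
by rewrite (ge0_integral_pushforward mpair).
Qed.

Lemma integral_joint_mul (q : S -> R) :
  measurable_fun setT q ->
  mu1.-integrable setT (EFin \o q) -> mu2.-integrable setT (EFin \o q) ->
  \int[mu1]_y q y = 0 ->
  \int[P]_w (q (Y w) * q (Z w)) = 0.
Proof.
move=> mq i1 i2 q0.
pose F (p : S * S) := (q p.1 * q p.2)%:E.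
have mF : measurable_fun setT F by rewrite /F; meas.
have absF : (\int[mu1 \x mu2]_p `|F p| < +oo)%E.
  have maF : measurable_fun setT (fun p => `|F p|)%E by exact: measurableT_comp.
  rewrite (fubini_tonelli1 _ maF)//.
  have -> : (\int[mu1]_x (\int[mu2]_y `|F (x, y)|) =
      \int[mu1]_x (`|q x|%:E * \int[mu2]_y `|q y|%:E))%E.
    apply: eq_integral => x _; rewrite -ge0_integralZl//.
    + by apply: eq_integral => y _; rewrite /F /= normrM EFinM.
    + by meas.
  have /integrableP[_ a1] := i1; have /integrableP[_ a2] := i2.
  have n0 (m : {measure set S -> \bar R}) : (0 <= \int[m]_y `|q y|%:E)%E.
    by apply: integral_ge0 => y _; rewrite lee_fin.
  rewrite ge0_integralZr//; last by meas.
  by apply: lte_mul_pinfty => //; rewrite ge0_fin_numE.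
have iF : (mu1 \x mu2)%E.-integrable setT F by apply/integrableP.
have F0 : (\int[mu1 \x mu2]_p F p = 0)%E.
  rewrite -(integral21_prod_meas1 iF).
  rewrite (eq_integral (cst 0%E)) ?integral0// => y _.
  have q0E : (\int[mu1]_x (q x)%:E = 0)%E.
    by rewrite -[LHS]fineK ?(integrable_fin_num _ i1)// -[fine _]/(\int[mu1]_x q x) q0.
  rewrite /fubini_G /F; under eq_integral do rewrite /= EFinM.
  by rewrite integralZr// q0E mul0e.
rewrite /Rintegral (_ : (\int[P]_w _)%E = 0%E)// -F0.
have PE : (\int[P]_w (F \o pairYZ) w = \int[mu1 \x mu2]_p F p)%E.
  rewrite [LHS]integralE [RHS]integralE funepos_comp funeneg_comp.
  by congr (_ - _)%E; apply: ge0_integral_joint => //;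
    [exact: measurable_funepos|exact: measurable_funeneg].
by rewrite -PE.
Qed.

End joint_law.

Section uncorrelated.
Context d (Omega : measurableType d) (R : realType) (P : probability Omega R).

Lemma Rintegral_cstP (c : R) : \int[P]_w c = c.
Proof.
by rewrite Rintegral_cst// -[RHS]mulr1 -[1 in RHS]/(fine 1%E) -(probability_setT P).
Qed.

Lemma integrable_cstP (c : R) : P.-integrable setT (EFin \o (fun=> c)).
Proof. exact: finite_measure_integrable_cst. Qed.

Lemma integrable_of_sq (Z : Omega -> R) : measurable_fun setT Z ->
  P.-integrable setT (EFin \o (fun w => Z w ^+ 2)) -> P.-integrable setT (EFin \o Z).
Proof.
move=> mZ iZ.
apply: (@le_integrableR _ _ R P _ (fun w => 1 + Z w ^+ 2)) => //.
  move=> w; have := sqr_ge0 (`|Z w| - 1); rewrite -[Z w ^+ 2]real_normK ?num_real//.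
  by have := normr_ge0 (Z w); nra.
have := integrableD measurableT (integrable_cstP 1) iZ.
by apply: eq_integrable.
Qed.

Lemma integrable_mul_sq (Z1 Z2 : Omega -> R) :
  measurable_fun setT Z1 -> measurable_fun setT Z2 ->
  P.-integrable setT (EFin \o (fun w => Z1 w ^+ 2)) ->
  P.-integrable setT (EFin \o (fun w => Z2 w ^+ 2)) ->
  P.-integrable setT (EFin \o (fun w => Z1 w * Z2 w)).
Proof.
move=> m1 m2 i1 i2.
apply: (@le_integrableR _ _ R P _ (fun w => Z1 w ^+ 2 + Z2 w ^+ 2)).
- exact: measurable_funM.
- move=> w; rewrite normrM -[Z1 w ^+ 2]real_normK ?num_real//.
  rewrite -[Z2 w ^+ 2]real_normK ?num_real//.
  have := sqr_ge0 (`|Z1 w| - `|Z2 w|).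
  by have := normr_ge0 (Z1 w); have := normr_ge0 (Z2 w); nra.
have := integrableD measurableT i1 i2.
by apply: eq_integrable.
Qed.

(** Pythagoras: the cross terms of uncorrelated centered variables vanish. *)
Lemma Rintegral_sq_affine_sum (n : nat) (Z : nat -> Omega -> R) (a b : R) :
  (forall k, measurable_fun setT (Z k)) ->
  (forall k, P.-integrable setT (EFin \o (fun w => Z k w ^+ 2))) ->
  (forall k, \int[P]_w Z k w = 0) ->
  (forall k l, k != l -> \int[P]_w (Z k w * Z l w) = 0) ->
  P.-integrable setT (EFin \o (fun w => (a * (\sum_(k < n) Z k w) + b) ^+ 2)) /\
  \int[P]_w (a * (\sum_(k < n) Z k w) + b) ^+ 2 =
  a ^+ 2 * (\sum_(k < n) \int[P]_w Z k w ^+ 2) + b ^+ 2.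
Proof.
move=> mZ iZ2 EZ EZZ.
have iZZ (k l : 'I_n) : P.-integrable setT (EFin \o (fun w => a ^+ 2 * (Z k w * Z l w))).
  have := @integrableZl _ _ _ P setT measurableT (a ^+ 2) _
    (integrable_mul_sq (mZ k) (mZ l) (iZ2 k) (iZ2 l)).
  by apply: eq_integrable.
have iZ1 (k : 'I_n) : P.-integrable setT (EFin \o (fun w => (2 * a * b) * Z k w)).
  have := @integrableZl _ _ _ P setT measurableT (2 * a * b) _
    (integrable_of_sq (mZ k) (iZ2 k)).
  by apply: eq_integrable.
have R1 k := Rintegral_sum (index_enum 'I_n) (iZZ k).
have [R2 I2] := Rintegral_sum (index_enum 'I_n) (fun k => (R1 k).2).
have [R3 I3] := Rintegral_sum (index_enum 'I_n) iZ1.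
have ib := integrable_cstP (b ^+ 2).
have i23 : P.-integrable setT (EFin \o (fun w =>
    \sum_(k < n) \sum_(l < n) a ^+ 2 * (Z k w * Z l w) + \sum_(k < n) (2 * a * b) * Z k w)).
  have := integrableD measurableT I2 I3.
  by apply: eq_integrable.
have i4 : P.-integrable setT (EFin \o (fun w =>
    \sum_(k < n) \sum_(l < n) a ^+ 2 * (Z k w * Z l w) + \sum_(k < n) (2 * a * b) * Z k w + b ^+ 2)).
  have := integrableD measurableT i23 ib.
  by apply: eq_integrable.
have E : (fun w => (a * (\sum_(k < n) Z k w) + b) ^+ 2) = (fun w =>
    \sum_(k < n) \sum_(l < n) a ^+ 2 * (Z k w * Z l w) + \sum_(k < n) (2 * a * b) * Z k w + b ^+ 2).
  apply/funext => w; rewrite -mulr_sumr.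
  under [in RHS]eq_bigr do rewrite -mulr_sumr -mulr_sumr.
  by rewrite -mulr_sumr -mulr_suml; ring.
rewrite E; split=> //.
rewrite RintegralD// RintegralD// R2 R3 Rintegral_cstP; congr (_ + _).
rewrite [X in _ + X]big1 ?addr0; last first.
  by move=> k _; rewrite RintegralZl ?EZ ?mulr0//; exact: integrable_of_sq.
rewrite mulr_sumr; apply: eq_bigr => k _; rewrite (R1 k).1 (bigD1 k)//= big1 ?addr0.
  rewrite RintegralZl//; last exact: integrable_mul_sq.
move=> l lk; rewrite RintegralZl//; last exact: integrable_mul_sq.
by rewrite EZZ ?mulr0// eq_sym; apply: contra lk => /eqP/val_inj ->.
Qed.

End uncorrelated.

Section sample_mean.
Context {R : realType} {d : nat} {dOmega : measure_display}
  {Omega : measurableType dOmega} (P : probability Omega R)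
  (X : nat -> {RV P >-> 'rV[R]_d}) (f : 'rV[R]_d -> R).
Notation Rd := 'rV[R]_d.
Hypotheses (X_indep : mutually_independent X) (f_ge0 : forall x, 0 <= f x)
  (mf : measurable_fun setT f) (X_density : common_density X f).

Lemma integral_density1 : (\int[leb d]_x (f x)%:E = 1)%E.
Proof.
by rewrite -(X_density 0 measurableT) /distribution /= /pushforward preimage_setT probability_setT.
Qed.

Lemma ge0_expectation_density k (g : Rd -> \bar R) : measurable_fun setT g ->
  (forall x, 0 <= g x)%E ->
  (\int[P]_w g (X k w) = \int[leb d]_y (g y * (f y)%:E))%E.
Proof.
move=> mg g0.
rewrite -(ge0_integral_density (mu := leb d) (nu := distribution P (X k)) mf f_ge0)//.
  by rewrite ge0_integral_distribution.
by move=> A mA; exact: X_density.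
Qed.

(** Since f >= 0, multiplying by f commutes with taking positive and negative
    parts; the identity then needs no integrability. *)
Lemma expectation_density k (g : Rd -> R) : measurable_fun setT g ->
  \int[P]_w g (X k w) = \int[leb d]_y (g y * f y).
Proof.
move=> mg; rewrite /Rintegral; congr fine.
have mgE : measurable_fun setT (EFin \o g) by exact/measurable_EFinP.
rewrite [LHS]integralE [RHS]integralE; congr (_ - _)%E.
- transitivity (\int[P]_w (EFin \o g)^\+ (X k w))%E.
    by apply: eq_integral => w _; rewrite !funeposE.
  rewrite ge0_expectation_density//; last exact: measurable_funepos.
  apply: eq_integral => y _; rewrite !funeposE /= -!EFin_max.
  by rewrite -EFinM maxr_pMl// mul0r.
- transitivity (\int[P]_w (EFin \o g)^\- (X k w))%E.
    by apply: eq_integral => w _; rewrite !funenegE.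
  rewrite ge0_expectation_density//; last exact: measurable_funeneg.
  apply: eq_integral => y _; rewrite !funenegE /= -!EFin_max.
  by rewrite -EFinM maxr_pMl// mul0r mulNr.
Qed.

(** The two-element case of mutual independence. *)
Lemma pair_independent k l (A B : set Rd) : k != l -> measurable A -> measurable B ->
  P (X k @^-1` A `&` X l @^-1` B) =
  (distribution P (X k) A * distribution P (X l) B)%E.
Proof.
move=> kl mA mB.
have := X_indep (s := [:: k; l]) (A := fun j => if j == k then A else B).
rewrite !big_cons big_nil mule1 eqxx eq_sym (negbTE kl) => <-.
- congr (P _); apply/seteqP; split => w /=.
  + move=> [wA wB] j /=; rewrite !inE => /orP[/eqP->|/eqP->]; first by rewrite eqxx.
    by rewrite eq_sym (negbTE kl).
  + move=> h; split; first by have := h k; rewrite /= eqxx mem_head; exact.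
    by have := h l; rewrite /= eq_sym (negbTE kl) !inE eqxx orbT; exact.
- by rewrite /= inE kl.
- by move=> j; case: ifP.
Qed.

Let mX k : measurable_fun setT (X k : Omega -> Rd).
Proof. exact: measurable_funP. Qed.

Let mcomp k (g : Rd -> R) : measurable_fun setT g ->
  measurable_fun setT (fun w => g (X k w)).
Proof. by move=> mg; exact: measurableT_comp mg (mX k). Qed.

(** Mean squared error is variance plus squared bias, and a variance is at most
    a second moment.  If the second moment of g is infinite the bound is
    trivial, so it may be assumed finite. *)
Lemma sample_mean_sq (n : nat) (g : Rd -> R) (c : R) : (0 < n)%N ->
  measurable_fun setT g ->
  (\int[P]_w ((n%:R^-1 * (\sum_(k < n) g (X k w)) - c) ^+ 2)%:E <=
   n%:R^-1%:E * \int[leb d]_y (g y ^+ 2 * f y)%:E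
   + ((\int[leb d]_y (g y * f y) - c) ^+ 2)%:E)%E.
Proof.
move=> n0 mg.
have nr0 : 0 < n%:R^-1 :> R by rewrite invr_gt0 ltr0n.
set Q := (\int[leb d]_y (g y ^+ 2 * f y)%:E)%E.
have Q0 : (0 <= Q)%E by apply: integral_ge0 => y _; rewrite lee_fin mulr_ge0// sqr_ge0.
have [->|Qfin] := eqVneq Q +oo%E.
  by rewrite gt0_muley ?lte_fin// addye// leey.
have {}Qfin : (Q < +oo)%E by rewrite ltey.
have QE k : (\int[P]_w (g (X k w) ^+ 2)%:E = Q)%E.
  have mg2 : measurable_fun setT (fun y => (g y ^+ 2)%:E : \bar R).
    by apply/measurable_EFinP; exact: measurable_funX.
  have := @ge0_expectation_density k _ mg2; rewrite /Q => ->.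
    by apply: eq_integral => y _; rewrite EFinM.
  by move=> y; rewrite lee_fin sqr_ge0.
have ig2 k : P.-integrable setT (EFin \o (fun w => g (X k w) ^+ 2)).
  apply/integrableP; split.
    by apply/measurable_EFinP; apply: measurable_funX; exact: mcomp.
  rewrite (eq_integral (fun w => (g (X k w) ^+ 2)%:E)) ?QE// => w _.
  by rewrite gee0_abs// lee_fin sqr_ge0.
have ig k : P.-integrable setT (EFin \o (fun w => g (X k w))).
  by apply: integrable_of_sq; [exact: mcomp|exact: ig2].
set m := \int[leb d]_y (g y * f y).
have Em k : \int[P]_w g (X k w) = m by exact: expectation_density.
pose q y := g y - m.
have mq : measurable_fun setT q by exact: measurable_funB.
pose Z k w := q (X k w).
have mZ k : measurable_fun setT (Z k) by exact: mcomp.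
have iZ k : P.-integrable setT (EFin \o Z k).
  have := integrableB measurableT (ig k) (integrable_cstP P m).
  by apply: eq_integrable.
have EZ k : \int[P]_w Z k w = 0.
  by rewrite /Z /q RintegralB// ?Em ?Rintegral_cstP ?subrr//; exact: integrable_cstP.
have i2m k : P.-integrable setT (EFin \o (fun w => 2 * m * g (X k w))).
  have := @integrableZl _ _ _ P setT measurableT (2 * m) _ (ig k).
  by apply: eq_integrable.
have i3 k : P.-integrable setT (EFin \o (fun w => g (X k w) ^+ 2 - 2 * m * g (X k w))).
  have := integrableB measurableT (ig2 k) (i2m k).
  by apply: eq_integrable.
have ZE k : (fun w => Z k w ^+ 2) =
    (fun w => g (X k w) ^+ 2 - 2 * m * g (X k w) + m ^+ 2).
  by apply/funext => w; rewrite /Z /q; ring.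
have iZ2 k : P.-integrable setT (EFin \o (fun w => Z k w ^+ 2)).
  rewrite ZE; have := integrableD measurableT (i3 k) (integrable_cstP P (m ^+ 2)).
  by apply: eq_integrable.
have EZ2 k : \int[P]_w Z k w ^+ 2 <= fine Q.
  rewrite ZE RintegralD//; last exact: integrable_cstP.
  rewrite RintegralB// Rintegral_cstP RintegralZl// Em.
  rewrite /Rintegral QE; have := sqr_ge0 m; lra.
have EZZ k l : k != l -> \int[P]_w (Z k w * Z l w) = 0.
  move=> kl.
  have iq j : (distribution P (X j)).-integrable setT (EFin \o q).
    have mqE : measurable_fun setT (EFin \o q) by exact/measurable_EFinP.
    apply/integrableP; split => //.
    rewrite ge0_integral_distribution//; last exact: measurableT_comp.
    by have /integrableP[_] := iZ j.
  apply: (@integral_joint_mul _ _ _ _ _ P (distribution P (X k)) (distribution P (X l)) (X k) (X l)) => //.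
  - by move=> A B mA mB; exact: pair_independent.
  - exact: iq.
  - exact: iq.
  rewrite -(EZ k) /Rintegral; congr fine.
  have mqE : measurable_fun setT (EFin \o q) by exact/measurable_EFinP.
  exact: (@integral_distribution _ _ _ _ _ P (X k) (EFin \o q) mqE (iZ k)).
have [iS ES] := @Rintegral_sq_affine_sum _ _ _ P n Z n%:R^-1 (m - c) mZ iZ2 EZ EZZ.
have nn : n%:R != 0 :> R by rewrite pnatr_eq0 -lt0n.
have SE w : n%:R^-1 * (\sum_(k < n) g (X k w)) - c =
    n%:R^-1 * (\sum_(k < n) Z k w) + (m - c).
  rewrite /Z /q big_split/= sumr_const card_ord -[(- m) *+ n]mulr_natl; move: (\sum_(k < n) _) => s.
  by field.
under eq_integral do rewrite SE.
rewrite -[leLHS]fineK; last exact: integrable_fin_num iS.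
rewrite -[fine _]/(\int[P]_w (n%:R^-1 * (\sum_(k < n) Z k w) + (m - c)) ^+ 2) ES.
rewrite -[Q]fineK ?ge0_fin_numE// -EFinM -EFinD lee_fin lerD2r.
rewrite (@le_trans _ _ (n%:R^-1 ^+ 2 * (\sum_(k < n) fine Q)))//.
  by rewrite ler_wpM2l ?sqr_ge0//; apply: ler_sum => k _; exact: EZ2.
rewrite sumr_const card_ord -[fine Q *+ n]mulr_natl.
by rewrite le_eqVlt; apply/orP; left; apply/eqP; field.
Qed.

End sample_mean.

(** * Mean integrated squared error *)

Section mise.
Context {R : realType} {d : nat} {dOmega : measure_display}
  {Omega : measurableType dOmega} (P : probability Omega R)
  (X : nat -> {RV P >-> 'rV[R]_d}) (f K : 'rV[R]_d -> R) (H : 'rV[R]_d -> 'M[R]_d).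
Notation Rd := 'rV[R]_d.

(** Positive and negative parts separately; the integrals on the right are
    finite because their multiples by |a|^d are. *)
Lemma Rintegral_leb_affine (a : R) (b : Rd) (F : Rd -> R) : a != 0 ->
  (leb d).-integrable setT (EFin \o F) ->
  \int[leb d]_x F x = `|a| ^+ d * \int[leb d]_x F (a *: x + b).
Proof.
move=> a0 iF; have mF : measurable_fun setT (EFin \o F) := measurable_int _ iF.
have c0 : 0 < `|a| ^+ d by rewrite exprn_gt0// normr_gt0.
have fin (A : \bar R) : (0 <= A -> (`|a| ^+ d)%:E * A \is a fin_num -> A \is a fin_num)%E.
  by case: A => // _; rewrite gt0_muley ?lte_fin.
rewrite /Rintegral [in LHS]integralE [in RHS]integralE.
have fp := integrable_fin_num measurableT (integrable_funepos measurableT iF).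
have fn := integrable_fin_num measurableT (integrable_funeneg measurableT iF).
have Ep := ge0_integral_leb_affine b a0 (measurable_funepos mF) (fun x => funepos_ge0 _ x).
have En := ge0_integral_leb_affine b a0 (measurable_funeneg mF) (fun x => funeneg_ge0 _ x).
rewrite Ep in fp *; rewrite En in fn *.
have -> : (\int[leb d]_x (fun x0 => (F (a *: x0 + b)%R)%:E)^\+ x =
   \int[leb d]_x (EFin \o F)^\+ (a *: x + b)%R)%E by apply: eq_integral => x _; rewrite !funeposE.
have -> : (\int[leb d]_x (fun x0 => (F (a *: x0 + b)%R)%:E)^\- x =
   \int[leb d]_x (EFin \o F)^\- (a *: x + b)%R)%E by apply: eq_integral => x _; rewrite !funenegE.
have {}fp : (\int[leb d]_x (EFin \o F)^\+ (a *: x + b)%R)%E \is a fin_num.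
  by apply: fin fp; apply: integral_ge0 => x _; exact: funepos_ge0.
have {}fn : (\int[leb d]_x (EFin \o F)^\- (a *: x + b)%R)%E \is a fin_num.
  by apply: fin fn; apply: integral_ge0 => x _; exact: funeneg_ge0.
by rewrite -(fineK fp) -(fineK fn) -!EFinM -!EFinB /= mulrBr.
Qed.

Lemma integrable_leb_affine (a : R) (b : Rd) (F : Rd -> R) : a != 0 ->
  (leb d).-integrable setT (EFin \o F) ->
  (leb d).-integrable setT (EFin \o (fun x => F (a *: x + b))).
Proof.
move=> a0 iF; have mF : measurable_fun setT (EFin \o F) := measurable_int _ iF.
have c0 : 0 < `|a| ^+ d by rewrite exprn_gt0// normr_gt0.
apply/integrableP; split.
  exact: (measurableT_comp mF (measurable_rV_affine a b)).
have /integrableP[_] := iF.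
have maF : measurable_fun setT (fun x => `|(EFin \o F) x|)%E by exact: measurableT_comp.
rewrite (ge0_integral_leb_affine b a0 maF) /=; last by move=> x; rewrite lee_fin.
set I := (\int[leb d]_x _)%E.
have : (0 <= I)%E by apply: integral_ge0 => x _; rewrite lee_fin.
by case: I => [r _ _|_|//]; rewrite ?ltry// gt0_muley ?lte_fin.
Qed.

Hypotheses (X_indep : mutually_independent X) (f_ge0 : forall x, 0 <= f x)
  (mf : measurable_fun setT f) (X_density : common_density X f)
  (f_C11 : C11 f)
  (H_meas : forall i j, measurable_fun setT (fun x => H x i j))
  (H_weak : weak_hessian f H).
Hypotheses (K_int : (leb d).-integrable setT (EFin \o K))
  (K_int2 : (leb d).-integrable setT (EFin \o (fun u => K u ^+ 2)))
  (K_int1 : \int[leb d]_u K u = 1)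
  (K_mean0 : forall i, \int[leb d]_u (u ord0 i * K u) = 0)
  (K_moment2 : (\int[leb d]_u (enorm u ^+ 2 * `|K u|)%:E < +oo)%E).

Let mK : measurable_fun setT K.
Proof. by apply/measurable_EFinP; exact: measurable_int K_int. Qed.

Let mX k : measurable_fun setT (X k : Omega -> Rd).
Proof. exact: measurable_funP. Qed.

Lemma integrable_density : (leb d).-integrable setT (EFin \o f).
Proof.
apply/integrableP; split; first exact/measurable_EFinP.
rewrite (eq_integral (EFin \o f)) => [|x _]; last by rewrite gee0_abs// lee_fin.
by rewrite (integral_density1 X_density) ltry.
Qed.

(** As a function of y, this is averaged over the sample to give the kernel
    estimator at x. *)
Definition rescaled (h : R) (x y : Rd) : R := (h ^+ d)^-1 * K (h^-1 *: (x - y)).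

Lemma kdeE h n w x : kde X K h n w x = n%:R^-1 * \sum_(k < n) rescaled h x (X k w).
Proof. by rewrite /kde /rescaled -mulr_sumr invfM mulrA. Qed.

(** Substitute u = (x - y)/h, and use that K has integral 1. *)
Lemma rescaled_bias h x : 0 < h ->
  \int[leb d]_y (rescaled h x y * f y) - f x = kbias K f h x.
Proof.
move=> h0; have hn0 := lt0r_neq0 h0.
have ishift := integrable_kernel_shift integrable_density f_ge0 f_C11 K_int K_moment2 h x.
have hi0 : - h^-1 != 0 by rewrite oppr_eq0 invr_eq0.
have ifx : (leb d).-integrable setT (EFin \o (fun u => K u * f x)).
  have := @integrableZl _ _ _ (leb d) setT measurableT (f x) _ K_int.
  by apply: eq_integrable => // u _ /=; rewrite -EFinM mulrC.
rewrite /kbias.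
rewrite [RHS](@eq_Rintegral _ _ _ (leb d) setT (fun u => K u * f (x - h *: u) - K u * f x)); last first.
  by move=> u _; rewrite mulrBr.
rewrite [RHS]RintegralB//.
have -> : \int[leb d]_u (K u * f x) = f x.
  rewrite (@eq_Rintegral _ _ _ (leb d) setT (fun u => f x * K u)); last first.
    by move=> u _; rewrite mulrC.
  by rewrite RintegralZl// K_int1 mulr1.
congr (_ - _).
rewrite (Rintegral_leb_affine (h^-1 *: x) hi0 ishift) normrN gtr0_norm ?invr_gt0//.
rewrite -RintegralZl//; last exact: integrable_leb_affine hi0 ishift.
apply: eq_Rintegral => y _.
have -> : - h^-1 *: y + h^-1 *: x = h^-1 *: (x - y) by rewrite scalerBr scaleNr addrC.
rewrite scalerA mulfV// scale1r subKr /rescaled -exprVn; ring.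
Qed.

(** Integrating in x first, each y contributes R(K) / h^d times f(y). *)
Lemma rescaled_sq_integral h : 0 < h ->
  (\int[leb d]_x \int[leb d]_y (rescaled h x y ^+ 2 * f y)%:E = (RK K / h ^+ d)%:E)%E.
Proof.
move=> h0; have hd0 : 0 < h ^+ d by rewrite exprn_gt0.
have mr : measurable_fun setT (fun p : Rd * Rd => (rescaled h p.1 p.2 ^+ 2 * f p.2)%:E).
  by rewrite /rescaled; meas.
rewrite (fubini_tonelli (m1 := leb d) (m2 := leb d) _ mr); last first.
  by move=> p; rewrite lee_fin mulr_ge0// sqr_ge0.
have mK2 : measurable_fun setT (fun u => (K u ^+ 2)%:E) by meas.
have RKE : (\int[leb d]_u (K u ^+ 2)%:E = (RK K)%:E)%E.
  by rewrite /RK /Rintegral fineK//; exact: integrable_fin_num K_int2.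
have inner y : (\int[leb d]_x (rescaled h x y ^+ 2 * f y)%:E =
    (RK K / h ^+ d)%:E * (f y)%:E)%E.
  have := @ge0_integral_leb_affine _ d h^-1 (- (h^-1 *: y)) (fun u => (K u ^+ 2)%:E).
  rewrite RKE normfV gtr0_norm// exprVn => /(_ _ mK2) E.
  have {}E : ((RK K)%:E = ((h ^+ d)^-1)%:E * \int[leb d]_x (K (h^-1 *: (x - y)) ^+ 2)%:E)%E.
    rewrite E ?invr_eq0 ?gt_eqF//; last by move=> u; rewrite lee_fin sqr_ge0.
    by congr (_ * _)%E; apply: eq_integral => x _; rewrite scalerBr.
  transitivity ((((h ^+ d)^-1 ^+ 2 * f y)%:E) * \int[leb d]_x (K (h^-1 *: (x - y)) ^+ 2)%:E)%E.
    rewrite -ge0_integralZl//.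
    - by apply: eq_integral => x _; rewrite /rescaled -EFinM; congr EFin; ring.
    - by meas.
    - by move=> x _; rewrite lee_fin sqr_ge0.
    - by rewrite lee_fin mulr_ge0// sqr_ge0.
  move: E; case: (\int[leb d]_x _)%E => [i| |].
  - by move=> [->]; rewrite -!EFinM; congr EFin; ring.
  - by rewrite gt0_muley ?lte_fin// invr_gt0.
  - by rewrite gt0_muleNy ?lte_fin// invr_gt0.
rewrite /=; under eq_integral do rewrite inner.
rewrite integralZl//; last exact: integrable_density.
by rewrite (integral_density1 X_density) mule1.
Qed.

(** Tonelli, and [sample_mean_sq] at each x for the rescaled kernel. *)
Theorem MISE_le (h W : R) (n : nat) : 0 < h -> (0 < n)%N -> 0 < W ->
  (\int[leb d]_u (enorm u ^+ 2 * `|K u|)%:E <= W%:E)%E ->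
  (MISE X K f h n <= (RK K / (n%:R * h ^+ d))%:E +
    (h ^+ 4 * W ^+ 2)%:E * \int[leb d]_x (abs_entries H x ^+ 2)%:E)%E.
Proof.
move=> h0 n0 W0 KW.
have if1 := integrable_density.
rewrite /MISE.
have mXk k : measurable_fun setT (fun p : Omega * Rd => X k p.1).
  exact: (measurableT_comp (mX k) measurable_fst).
have mkde : measurable_fun setT (fun p : Omega * Rd => ((kde X K h n p.1 p.2 - f p.2) ^+ 2)%:E).
  apply/measurable_EFinP; apply: measurable_funX; apply: measurable_funB; last by meas.
  rewrite /kde; apply: measurable_funM => //; apply: measurable_fun_bigsum => k.
  apply: (measurableT_comp mK); apply: measurable_rVZ => //.
  apply: measurable_rVD; first exact: measurable_snd.
  exact: measurable_rVN.
rewrite (fubini_tonelli (m1 := P) (m2 := leb d) _ mkde); last first.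
  by move=> p; rewrite lee_fin sqr_ge0.
have mb : measurable_fun setT (kbias K f h).
  apply: (@measurable_integral_param R _ _ Rd Rd (leb d)
      (fun p => K p.2 * (f (p.1 - h *: p.2) - f p.1))).
  by meas.
have mr : measurable_fun setT (fun p : Rd * Rd => (rescaled h p.1 p.2 ^+ 2 * f p.2)%:E).
  by rewrite /rescaled; meas.
have mV : measurable_fun setT (fun x => \int[leb d]_y (rescaled h x y ^+ 2 * f y)%:E)%E.
  apply: (@measurable_eintegral_param R _ _ Rd Rd (leb d)
    (fun p => (rescaled h p.1 p.2 ^+ 2 * f p.2)%:E)) => //.
  by move=> p; rewrite lee_fin mulr_ge0// sqr_ge0.
have V0 x : (0 <= \int[leb d]_y (rescaled h x y ^+ 2 * f y)%:E)%E.
  by apply: integral_ge0 => y _; rewrite lee_fin mulr_ge0// sqr_ge0.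
have nr0 : 0 <= n%:R^-1 :> R by rewrite invr_ge0.
apply: (@le_trans _ _ (\int[leb d]_x (n%:R^-1%:E *
    \int[leb d]_y (rescaled h x y ^+ 2 * f y)%:E + (kbias K f h x ^+ 2)%:E)%E)%E).
  apply: ge0_le_integral => //=.
  - by move=> x _; apply: integral_ge0 => w _; rewrite lee_fin sqr_ge0.
  - apply: (measurable_fun_fubini_tonelli_G (m1 := P) _ mkde).
    by move=> p; rewrite lee_fin sqr_ge0.
  - apply: emeasurable_funD; first exact: emeasurable_funM.
    by apply/measurable_EFinP; exact: measurable_funX.
  - move=> x _; under eq_integral do rewrite kdeE.
    rewrite -rescaled_bias//.
    apply: (sample_mean_sq X_indep f_ge0 mf X_density (f x) n0).
    by rewrite /rescaled; meas.
rewrite ge0_integralD//; last 4 first.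
- by move=> x _; rewrite mule_ge0.
- exact: emeasurable_funM.
- by move=> x _; rewrite lee_fin sqr_ge0.
- by apply/measurable_EFinP; exact: measurable_funX.
rewrite ge0_integralZl// rescaled_sq_integral//.
apply: leeD.
  by rewrite -EFinM lee_fin le_eqVlt; apply/orP; left; apply/eqP; rewrite invfM; ring.
exact: (bias_L2 if1 f_ge0 f_C11 H_meas H_weak K_int K_mean0 K_moment2).
Qed.

End mise.

(** * Minimizing the asymptotic error *)

Section amise_minimizer.
Context {R : realType}.
Implicit Types (s t : R) (d : nat).

(* Both factors have the sign of s - 1. *)
Let increment_gt0 s d : 0 < s -> s != 1 ->
  0 < (s - 1) * (s * s ^+ d * (s ^+ 3 + s ^+ 2 + s + 1) - 4).
Proof.
move=> s0 s1; set p := s ^+ d.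
move: s1; rewrite neq_lt => /orP[s1|s1].
  rewrite nmulr_rgt0 ?subr_lt0//.
  have p0 : 0 <= p by rewrite exprn_ge0// ltW.
  have p1 : p <= 1 by rewrite /p exprn_ile1// ltW.
  have sp : s * p <= 1 by rewrite mulr_ile1// ltW.
  have sp0 : 0 <= s * p by rewrite mulr_ge0// ltW.
  have : s ^+ 3 + s ^+ 2 + s + 1 < 4.
    by have := exprn_ile1 3 (ltW s0) (ltW s1); have := exprn_ile1 2 (ltW s0) (ltW s1); lra.
  have : 0 <= s ^+ 3 + s ^+ 2 + s + 1 by rewrite !addr_ge0 ?exprn_ge0// ltW.
  nra.
apply: mulr_gt0; first by rewrite subr_gt0.
have p1 : 1 <= p by rewrite /p exprn_ege1// ltW.
have sp : 1 <= s * p by rewrite mulr_ege1// ltW.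
have : 4 < s ^+ 3 + s ^+ 2 + s + 1.
  by have := exprn_ege1 3 (ltW s1); have := exprn_ege1 2 (ltW s1); lra.
nra.
Qed.

(** Weighted arithmetic-geometric mean inequality with weights d and 4 for
    s^{d+4} and 1.  Writing P(d) for right minus left side, one has
    P(d+1) = s P(d) + (s - 1) (s^{d+1} (s^3 + s^2 + s + 1) - 4),
    whose last term is positive. *)
Lemma weighted_power_gt s d : 0 < s -> s != 1 -> (0 < d)%N ->
  (d%:R + 4) * s ^+ d < d%:R * s ^+ (d + 4) + 4.
Proof.
move=> s0 s1; case: d => // d _; elim: d => [|d IH].
  have := increment_gt0 0 s0 s1; rewrite expr0 mulr1 expr1.
  have -> : s ^+ (1 + 4) = s * s ^+ 3 * s by rewrite -exprS -exprSr.
  by rewrite [s ^+ 3]exprS expr2; lra.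
have := increment_gt0 d.+1 s0 s1; rewrite -[d.+2%:R]natr1.
move: IH; rewrite [s ^+ d.+2]exprS [(d.+2 + 4)%N]addSn [s ^+ (d.+1 + 4).+1]exprS.
set p := s ^+ d.+1; set q := s ^+ (d.+1 + 4).
have qE : q = p * s ^+ 4 by rewrite /q exprD.
rewrite -(ltr_pM2l s0) => IH h.
have s4 : s ^+ 4 = s * s ^+ 3 by rewrite exprS.
have s3 : s ^+ 3 = s * s ^+ 2 by rewrite exprS.
rewrite qE in IH *; rewrite s4 s3 expr2 in IH h *; lra.
Qed.

(** The condition on hs says that the derivative vanishes there.  It eliminates
    b, and after t = s hs the difference of the two values is a positive
    multiple of the one in [weighted_power_gt]. *)
Lemma minimizer_amise (a b hs h : R) d : (0 < d)%N -> 0 < a -> 0 < b -> 0 < hs ->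
  4 * a * hs ^+ (d + 4) = d%:R * b ->
  minimizer [set t | 0 < t] (fun t => a * t ^+ 4 + b / t ^+ d) h <-> h = hs.
Proof.
move=> d0 a0 b0 hs0 hsE; set g := fun t => _.
have dr0 : 0 < d%:R :> R by rewrite ltr0n.
have strict t : 0 < t -> t != hs -> g hs < g t.
  move=> t0 ths; set s := t / hs.
  have s0 : 0 < s by rewrite divr_gt0.
  have s1 : s != 1.
    by apply: contra ths => /eqP s1; rewrite -(divfK (lt0r_neq0 hs0) t) -/s s1 mul1r.
  have tE : t = s * hs by rewrite /s divfK// gt_eqF.
  have bE : b = 4 * a * hs ^+ (d + 4) / d%:R by rewrite hsE mulrC mulKf// gt_eqF.
  have sd0 : 0 < s ^+ d by rewrite exprn_gt0.
  have hd0 : 0 < hs ^+ d by rewrite exprn_gt0.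
  clearbody s; rewrite -subr_gt0.
  have -> : g t - g hs = a * hs ^+ 4 / (d%:R * s ^+ d) *
      (d%:R * s ^+ (d + 4) + 4 - (d%:R + 4) * s ^+ d).
    rewrite /g bE tE !exprMn !exprD.
    by field; rewrite !gt_eqF.
  apply: mulr_gt0; last by rewrite subr_gt0 weighted_power_gt.
  by rewrite divr_gt0 ?mulr_gt0 ?exprn_gt0.
split=> [[h0 hmin]|->].
  apply/eqP; apply: contraT => hhs.
  by have := lt_le_trans (strict h h0 hhs) (hmin hs hs0); rewrite ltxx.
split=> // t t0; have [->//|ths] := eqVneq t hs.
exact/ltW/strict.
Qed.

Lemma powR_root_exprn (x : R) n : 0 <= x -> (0 < n)%N -> (x `^ (1 / n%:R)) ^+ n = x.
Proof.
move=> x0 n0; rewrite -powR_mulrn ?powR_ge0// -powRrM div1r mulVf ?powRr1//.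
by rewrite pnatr_eq0 -lt0n.
Qed.

End amise_minimizer.

(** * Square-integrable kernels and Hessians *)

Section L2_facts.
Context {R : realType} {d : nat}.
Notation Rd := 'rV[R]_d.

(** Otherwise K would vanish almost everywhere, against its integral being 1. *)
Lemma RK_gt0 (K : Rd -> R) : measurable_fun setT K ->
  (leb d).-integrable setT (EFin \o (fun u => K u ^+ 2)) ->
  \int[leb d]_u K u = 1 -> 0 < RK K.
Proof.
move=> mK iK2 K1; rewrite lt_neqAle; apply/andP; split; last first.
  by apply: Rintegral_ge0 => u _; exact: sqr_ge0.
apply/eqP => RK0.
have mK2 : measurable_fun setT (fun u => (K u ^+ 2)%:E : \bar R).
  by apply/measurable_EFinP; exact: measurable_funX.
have I0 : (\int[leb d]_u `|(K u ^+ 2)%:E| = 0)%E.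
  rewrite (eq_integral (fun u => (K u ^+ 2)%:E)).
    by rewrite -[LHS]fineK ?(integrable_fin_num _ iK2)// -[fine _]/(RK K) -RK0.
  by move=> u _; rewrite gee0_abs// lee_fin sqr_ge0.
have ae0 := (ae_eq_integral_abs (leb d) measurableT mK2).1 I0.
have aeK : ae_eq (leb d) setT (EFin \o K) (cst 0%E).
  apply: filterS ae0 => u /= /(_ I) h _; apply/eqP; move/eqP: h.
  by rewrite !eqe sqrf_eq0.
have : (\int[leb d]_u (K u)%:E = 0)%E.
  rewrite -[RHS](@integral0 _ _ _ (leb d) setT); apply: ae_eq_integral => //.
  exact/measurable_EFinP.
by move=> h; move: K1; rewrite /Rintegral h => /eqP; rewrite eq_sym oner_eq0.
Qed.

(** The square is a sum of products of two square-integrable entries. *)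
Lemma abs_entries_L2 (H : Rd -> 'M[R]_d) :
  (forall i j, (fun x => H x i j) \in Lfun (leb d) 2%:E) ->
  (\int[leb d]_x (abs_entries H x ^+ 2)%:E < +oo)%E.
Proof.
move=> HL.
have i4 i j k l : (leb d).-integrable setT (EFin \o (fun x => `|H x i j| * `|H x k l|)).
  have := integrable_norm ((Lfun1_integrable _ _).1 (Lfun2_mul_Lfun1 (HL i j) (HL k l))).
  by apply: eq_integrable => // x _ /=; rewrite normrM.
have i3 i j k := (Rintegral_sum (index_enum 'I_d) (i4 i j k)).2.
have i2 i j := (Rintegral_sum (index_enum 'I_d) (i3 i j)).2.
have i1 i := (Rintegral_sum (index_enum 'I_d) (i2 i)).2.
have i0 := (Rintegral_sum (index_enum 'I_d) i1).2.
have -> : (fun x => (abs_entries H x ^+ 2)%:E) = EFin \o (fun x : Rd =>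
    \sum_(i < d) \sum_(j < d) \sum_(k < d) \sum_(l < d) `|H x i j| * `|H x k l|).
  apply/funext => x /=; congr EFin; rewrite expr2 {1}/abs_entries mulr_suml.
  apply: eq_bigr => i _; rewrite mulr_suml; apply: eq_bigr => j _.
  by rewrite /abs_entries mulr_sumr; apply: eq_bigr => k _; rewrite mulr_sumr.
exact: integrable_lty i0.
Qed.

End L2_facts.

Theorem corollary6p5 (R : realType) (d : nat) (d_ge1 : (1 <= d)%N)
  (dOmega : measure_display) (Omega : measurableType dOmega)
  (P : probability Omega R) (X : nat -> {RV P >-> 'rV[R]_d})
  (f K : 'rV[R]_d -> R) (D2f : 'rV[R]_d -> 'M[R]_d)
  (X_indep : mutually_independent X)
  (f_ge0 : forall x, 0 <= f x)
  (X_density : common_density X f)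
  (K_L1 : K \in Lfun (leb d) 1%E)
  (K_L2 : K \in Lfun (leb d) 2%:E)
  (K_int1 : \int[leb d]_u K u = 1)
  (K_mean0 : forall i, \int[leb d]_u (u ord0 i * K u) = 0)
  (K_moment2 : (\int[leb d]_u (enorm u ^+ 2 * `|K u|)%:E < +oo)%E)
  (f_C11 : C11 f)
  (f_L2 : f \in Lfun (leb d) 2%:E)
  (D2f_weak : weak_hessian f D2f)
  (D2f_L2 : forall i j, (fun x => D2f x i j) \in Lfun (leb d) 2%:E) :
  (forall h : nat -> R,
     asymp h (fun n => n%:R `^ (- (1 / (d%:R + 4)))) ->
     exists C : R, \forall n \near \oo,
       (MISE X K f (h n) n <= (C * n%:R `^ (- (4 / (d%:R + 4))))%:E)%E)
  /\
  (0 < L2norm (LK K D2f) ->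
   forall n : nat, (1 <= n)%N ->
   forall h : R,
     minimizer [set t | 0 < t] (AMISE K D2f n) h <->
     h = (d%:R * RK K / (L2norm (LK K D2f) ^+ 2 * n%:R)) `^ (1 / (d%:R + 4))).
Proof.
have mLfun p (g : 'rV[R]_d -> R) : g \in Lfun (leb d) p -> measurable_fun setT g.
  by move=> /sub_Lfun_mfun; rewrite inE.
have mK := mLfun _ _ K_L1.
have mf := mLfun _ _ f_L2.
have K_int := (Lfun1_integrable _ _).1 K_L1.
have K_int2 := Lfun2_integrable_sqr K_L2.
have H_meas i j := mLfun _ _ (D2f_L2 i j).
have RK0 := RK_gt0 mK K_int2 K_int1.
split.
- move=> h [c [C [c0 hasymp]]].
  have K_mom : (0 <= \int[leb d]_u (enorm u ^+ 2 * `|K u|)%:E)%E.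
    by apply: integral_ge0 => u _; rewrite lee_fin mulr_ge0// sqr_ge0.
  (* The added 1 makes W positive even if the second moment were 0. *)
  pose W := fine (\int[leb d]_u (enorm u ^+ 2 * `|K u|)%:E)%E + 1.
  have W0 : 0 < W by rewrite ltr_wpDl// fine_ge0.
  have KW : (\int[leb d]_u (enorm u ^+ 2 * `|K u|)%:E <= W%:E)%E.
    by rewrite /W EFinD fineK ?ge0_fin_numE// leeDl// lee_fin.
  have HL := abs_entries_L2 D2f_L2.
  have H0 : (0 <= \int[leb d]_x (abs_entries D2f x ^+ 2)%:E)%E.
    by apply: integral_ge0 => u _; rewrite lee_fin sqr_ge0.
  pose M := fine (\int[leb d]_x (abs_entries D2f x ^+ 2)%:E)%E.
  have M0 : 0 <= M by rewrite fine_ge0.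
  (* The variance term decreases in h and uses h >= c p, where
     p = n^{-1/(d+4)}; the bias term uses h <= C p. *)
  exists (RK K / c ^+ d + C ^+ 4 * W ^+ 2 * M).
  near=> n.
  have n0 : (0 < n)%N by near: n; exact: nbhs_infty_gt.
  have nr0 : 0 < n%:R :> R by rewrite ltr0n.
  set e : R := d%:R + 4.
  have e0 : 0 < e by rewrite ltr_wpDl.
  set p := n%:R `^ (- (1 / e)).
  have p0 : 0 < p by rewrite powR_gt0.
  have : c <= h n / p <= C by rewrite /p /e; near: n.
  rewrite ler_pdivlMr// ler_pdivrMr// => /andP[ch hC].
  have h0 : 0 < h n by rewrite (lt_le_trans _ ch)// mulr_gt0.
  have p4 : p ^+ 4 = n%:R `^ (- (4 / e)).
    rewrite -powR_mulrn ?powR_ge0// -powRrM; congr (_ `^ _); field.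
    by rewrite gt_eqF.
  have pd : n%:R * p ^+ d = (n%:R `^ (- (4 / e)))^-1.
    rewrite -powR_mulrn ?powR_ge0// -powRrM -powRN -{1}[n%:R]powRr1 ?ltW//.
    rewrite -powRD ?(gt_eqF nr0) ?implybT//; congr (_ `^ _); rewrite /e; field.
    by rewrite gt_eqF.
  apply: le_trans (MISE_le X_indep f_ge0 mf X_density f_C11 H_meas D2f_weak K_int
    K_int2 K_int1 K_mean0 K_moment2 h0 n0 W0 KW) _.
  rewrite -[X in (_ + _ * X)%E]fineK ?ge0_fin_numE// -/M -EFinM -EFinD lee_fin.
  rewrite mulrDl lerD//.
    rewrite -[leRHS]mulrA ler_wpM2l ?(ltW RK0)//.
    have -> : (c ^+ d)^-1 * n%:R `^ (- (4 / e)) = (n%:R * (c * p) ^+ d)^-1.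
      by rewrite exprMn mulrCA pd invfM invrK.
    rewrite lef_pV2 ?posrE ?mulr_gt0 ?exprn_gt0 ?mulr_gt0//.
    by rewrite ler_wpM2l ?(ltW nr0)// lerXn2r// nnegrE ltW// mulr_gt0.
  have : h n ^+ 4 <= C ^+ 4 * n%:R `^ (- (4 / e)).
    by rewrite -p4 -exprMn lerXn2r// nnegrE ltW// (lt_le_trans h0).
  move=> /(ler_wpM2r (mulr_ge0 (sqr_ge0 W) M0)); rewrite mulrA => /le_trans; apply.
  by rewrite le_eqVlt; apply/orP; left; apply/eqP; ring.
- move=> L0 n n0 h.
  have nr0 : 0 < n%:R :> R by rewrite ltr0n.
  set Ln := L2norm _ in L0 *.
  set hs := _ `^ _.
  have x0 : 0 < d%:R * RK K / (Ln ^+ 2 * n%:R).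
    by rewrite divr_gt0 ?mulr_gt0 ?exprn_gt0 ?ltr0n.
  have -> : AMISE K D2f n = fun t => Ln ^+ 2 / 4 * t ^+ 4 + (RK K / n%:R) / t ^+ d.
    by apply/funext => t; rewrite /AMISE -/Ln invfM; ring.
  apply: minimizer_amise => //.
  - by rewrite divr_gt0// exprn_gt0.
  - by rewrite divr_gt0.
  - by rewrite powR_gt0.
  - have -> : hs ^+ (d + 4) = d%:R * RK K / (Ln ^+ 2 * n%:R).
      by rewrite /hs -natrD powR_root_exprn// ?ltW// addn_gt0 orbT.
    by field; rewrite !gt_eqF.
Unshelve. all: by end_near.
Qed.
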